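(* Let $F$ be a bipartite graph that is not a star and whose color surplus satisfies $\sigma(F)=|F|-\alpha(F)$. Then for all sufficiently large $m$, if $G$ is an $F$-free graph with $m$ edges, then $\lambda(G)\le\lambda(S_{\sigma(F)-1,m})$, with equality if and only if $G=S_{\sigma(F)-1,m}$.
   Context: All graphs are finite and simple; isolated vertices are ignored. $|F|$ is the number of vertices and $\alpha(F)$ the independence number of $F$. The color surplus $\sigma(F)$ of a bipartite graph $F$ is the minimum size of a color class over all proper $2$-colorings of $F$. Split graph: for $1\le k<m$, write $m-\binom{k}{2}=kt+s$ with integers $t\ge 1$ and $0\le s\le k-1$; $S_{k,m}$ is the $m$-edge graph obtained from $K_k\vee tK_1$ (a clique $K_k$ joined to $t$ independent vertices) by adding one extra vertex adjacent to exactly $s$ vertices of the $K_k$. $\lambda(G)$ is the spectral radius of the adjacency matrix; $F$-free means no subgraph isomorphic to $F$. *)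

(* Defs.v *)
From HB Require Import structures.
From mathcomp Require Import all_boot all_order all_algebra.
From mathcomp Require Import classical_sets reals.
Set Implicit Arguments. Unset Strict Implicit. Unset Printing Implicit Defensive.
Import Order.TTheory GRing.Theory Num.Theory.

(* A (simple) graph is a symmetric irreflexive relation E on a finType V.
   Following the paper, isolated vertices are ignored: the vertex set
   "V(G)" is the set of non-isolated vertices. *)
Definition simple_graph (V : finType) (E : rel V) : Prop :=
  symmetric E /\ irreflexive E.

Definition nonisol (V : finType) (E : rel V) (x : V) : bool := [exists y, E x y].

Definition order_g (V : finType) (E : rel V) : nat := #|[set x | nonisol E x]|.

Definition nedges (V : finType) (E : rel V) : nat :=
  #|[set e : {set V} | [exists x, exists y, E x y && (e == [set x; y])]]|.

Definition independent (V : finType) (E : rel V) (S : {set V}) : bool :=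
  [forall x in S, forall y in S, ~~ E x y].

Definition alpha (V : finType) (E : rel V) : nat :=
  \max_(S : {set V} | (S \subset [set x | nonisol E x]) && independent E S) #|S|.

Definition proper2 (V : finType) (E : rel V) (c : {ffun V -> bool}) : bool :=
  [forall x, forall y, E x y ==> (c x != c y)].

Definition bipartite (V : finType) (E : rel V) : Prop :=
  exists c : {ffun V -> bool}, proper2 E c.

Definition sigma (V : finType) (E : rel V) : nat :=
  \big[minn/#|V|]_(c : {ffun V -> bool} | proper2 E c)
     minn #|[set x | nonisol E x & c x]| #|[set x | nonisol E x & ~~ c x]|.

Definition is_star (V : finType) (E : rel V) : Prop :=
  exists v : V, forall x y, E x y -> x = v \/ y = v.

Definition subgraph (VF : finType) (EF : rel VF) (V : finType) (E : rel V) : Prop :=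
  exists f : VF -> V,
    (forall x y, nonisol EF x -> nonisol EF y -> f x = f y -> x = y) /\
    (forall x y, EF x y -> E (f x) (f y)).

Definition F_free (VF : finType) (EF : rel VF) (V : finType) (E : rel V) : Prop :=
  ~ subgraph EF E.

Definition isomorphic (V : finType) (E : rel V) (W : finType) (E' : rel W) : Prop :=
  exists f : V -> W,
    (forall x y, nonisol E x -> nonisol E y -> f x = f y -> x = y) /\
    (forall x, nonisol E x -> nonisol E' (f x)) /\
    (forall z, nonisol E' z -> exists x, nonisol E x /\ f x = z) /\
    (forall x y, nonisol E x -> nonisol E y -> E x y = E' (f x) (f y)).

Definition adj (R : realType) (V : finType) (E : rel V) : 'M[R]_#|V| :=
  \matrix_(i, j) ((E (enum_val i) (enum_val j))%:R)%R.

Local Open Scope classical_set_scope.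
Definition lambda (R : realType) (V : finType) (E : rel V) : R :=
  sup [set (`|a|)%R | a in [set a : R | eigenvalue (adj R E) a]].
Local Close Scope classical_set_scope.

(* Split graph S_{k,m}: write m - C(k,2) = k t + s with 0 <= s <= k-1.
   Vertices 0..k-1 form a clique K_k, vertices k..k+t-1 are independent and
   joined to the clique, and vertex k+t is adjacent to clique vertices
   0..s-1. *)
Definition split_t (k m : nat) : nat := (m - 'C(k, 2)) %/ k.
Definition split_s (k m : nat) : nat := (m - 'C(k, 2)) %% k.
Definition split_n (k m : nat) : nat := k + split_t k m + 1.

Definition split_adj0 (k t s : nat) (x y : nat) : bool :=
  [|| (x < k) && (y < k),
      (x < k) && (k <= y < k + t)
    | (x < s) && (y == k + t)].

Definition split_graph (k m : nat) : rel 'I_(split_n k m) :=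
  fun x y => (x != y) &&
    (split_adj0 k (split_t k m) (split_s k m) x y ||
     split_adj0 k (split_t k m) (split_s k m) y x).
Arguments split_graph k m : clear implicits.

(* Main.v *)
Require Import Defs.
From HB Require Import structures.
From mathcomp Require Import boolp classical_sets reals topology normedtype derive.
From mathcomp Require Import all_boot all_order all_algebra.
From mathcomp Require Import ring lra zify.
Set Implicit Arguments. Unset Strict Implicit. Unset Printing Implicit Defensive.
Import Order.TTheory GRing.Theory Num.Theory.
Import numFieldNormedType.Exports.
Local Open Scope ring_scope.

(** Put [k = sigma F - 1] and [b = |F|].  An [F]-free graph [G] contains no
    [K_{k+1,b}], and this is all that is used.  Assume
    [l = lambda G >= lambda (S_{k,m})], so that [l^2 - (k-1) l >= m - O(1)], and
    let [x] be a Perron vector with maximum [x_u = 1].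

    - Cauchy-Schwarz over the edges shows that the weights [x_v^2] span edge
      density bounded below, and a greedy choice of [k+1] vertices then
      contradicts [K_{k+1,b}]-freeness unless the norm of [x] is bounded; hence
      [L = {v : x_v >= 1/3}] has bounded size.
    - Comparing [l^2 - (k-1) l], expanded at [u], with the number of edges
      bounds a sum of nonnegative terms.  It follows that [|L| = k], that
      [x = 1 - O(l^-2)] on [L] and [x = O(1/l)] elsewhere, that only [O(1)]
      edges avoid [L], and that only [O(l)] vertices are joined to some but not
      to all of [L].
    - Eliminating the entries outside [L] by completing a square, both in [G] and
      in [S_{k,m}] with [x] transplanted to its clique, leaves an inequality
      between integers up to [O(1/l)].  It involves the function [d (k - d)] of the
      degrees into [L], whose subadditivity modulo [k] leaves only [S_{k,m}]. *)

(** * Quadratic forms and the spectral radius *)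

Definition normsq (R : pzRingType) (T : finType) (y : T -> R) : R :=
  \sum_v y v ^+ 2.

Definition apply_form (R : pzRingType) (T : finType) (a : T -> T -> R)
    (y : T -> R) (v : T) : R :=
  \sum_w a v w * y w.

Definition qform (R : pzRingType) (T : finType) (a : T -> T -> R) (y : T -> R) : R :=
  \sum_v \sum_w a v w * (y v * y w).

Definition eigenfun (R : pzRingType) (T : finType) (a : T -> T -> R) (c : R)
    (y : T -> R) : Prop :=
  forall v, apply_form a y v = c * y v.

Section QuadraticForms.
Variables (R : realFieldType) (T : finType) (a : T -> T -> R).
Implicit Types y z : T -> R.

Lemma normsq_ge0 y : 0 <= normsq y.
Proof. by apply: sumr_ge0 => v _; exact: sqr_ge0. Qed.

Lemma sqr_le_normsq y v : y v ^+ 2 <= normsq y.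
Proof.
by rewrite /normsq (bigD1 v) //= lerDl; apply: sumr_ge0 => w _; exact: sqr_ge0.
Qed.

Lemma normsq_gt0 y v : y v != 0 -> 0 < normsq y.
Proof.
by move=> yv0; apply: lt_le_trans (sqr_le_normsq y v); rewrite exprn_even_gt0.
Qed.

Lemma normsq_eq0P y : normsq y = 0 <-> forall v, y v = 0.
Proof.
split=> [y0 v|y0]; last by rewrite /normsq big1 // => v _; rewrite y0 expr0n.
by apply/eqP/negPn/negP => /normsq_gt0; rewrite y0 ltxx.
Qed.

Lemma normsq_norm y : normsq (fun v => `|y v|) = normsq y.
Proof. by apply: eq_bigr => v _; rewrite real_normK ?num_real. Qed.

Lemma normsqZ c y : normsq (fun v => c * y v) = c ^+ 2 * normsq y.
Proof. by rewrite /normsq mulr_sumr; apply: eq_bigr => v _; rewrite exprMn. Qed.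

Lemma normsqD y z :
  normsq (fun v => y v + z v) = normsq y + (\sum_v z v * y v) *+ 2 + normsq z.
Proof.
by rewrite /normsq -sumrMnl -!big_split; apply: eq_bigr => v _ /=; rewrite sqrrD mulrC.
Qed.

Lemma qformE y : qform a y = \sum_v y v * apply_form a y v.
Proof.
by apply: eq_bigr => v _; rewrite mulr_sumr; apply: eq_bigr => w _; rewrite mulrCA.
Qed.

Lemma qformZ c y : qform a (fun v => c * y v) = c ^+ 2 * qform a y.
Proof.
rewrite /qform mulr_sumr; apply: eq_bigr => v _; rewrite mulr_sumr.
by apply: eq_bigr => w _; ring.
Qed.

Lemma qform0 y : (forall v, y v = 0) -> qform a y = 0.
Proof. by move=> y0; rewrite qformE big1 // => v _; rewrite y0 mul0r. Qed.

Lemma qform_eigenfun c y : eigenfun a c y -> qform a y = c * normsq y.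
Proof.
move=> ay; rewrite qformE /normsq mulr_sumr.
by apply: eq_bigr => v _; rewrite ay mulrCA.
Qed.

Lemma apply_form_sym (a_sym : commutative a) y z :
  \sum_v z v * apply_form a y v = \sum_v y v * apply_form a z v.
Proof.
under eq_bigr do rewrite mulr_sumr.
rewrite exchange_big; apply: eq_bigr => v _; rewrite mulr_sumr /=.
by apply: eq_bigr => w _; rewrite a_sym mulrCA [RHS]mulrCA; congr (_ * _); exact: mulrC.
Qed.

Lemma qformD (a_sym : commutative a) y z :
  qform a (fun v => y v + z v) =
  qform a y + (\sum_v z v * apply_form a y v) *+ 2 + qform a z.
Proof.
rewrite mulr2n {2}apply_form_sym // !qformE -!big_split; apply: eq_bigr => v _ /=.
have -> : apply_form a (fun w => y w + z w) v = apply_form a y v + apply_form a z v.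
  by rewrite -big_split; apply: eq_bigr => w _; rewrite mulrDr.
by ring.
Qed.

Lemma qform_le_norm (a_ge0 : forall v w, 0 <= a v w) y :
  `|qform a y| <= qform a (fun v => `|y v|).
Proof.
apply: (le_trans (ler_norm_sum _ _ _)); apply: ler_sum => v _.
apply: (le_trans (ler_norm_sum _ _ _)); apply: ler_sum => w _.
by rewrite !normrM (ger0_norm (a_ge0 _ _)).
Qed.

(* Perturbing a maximizer [y] by [t] times the residual [r = a y - c y] changes
   the form [c |y|^2 - a(y,y) >= 0] by [- 2 t |r|^2 + O(t^2)]. *)
Lemma rayleigh_maximizer_eigenfun (a_sym : commutative a) c y :
  (forall z, qform a z <= c * normsq z) -> qform a y = c * normsq y -> eigenfun a c y.
Proof.
move=> ac ay; pose r v := apply_form a y v - c * y v.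
suff /normsq_eq0P r0 : normsq r = 0.
  by move=> v; apply/eqP; rewrite -subr_eq0 -[_ - _]/(r v) r0.
have normsq_r : normsq r = \sum_v r v * apply_form a y v - c * \sum_v r v * y v.
  rewrite mulr_sumr -sumrB; apply: eq_bigr => v _.
  by rewrite expr2 {2}/r mulrBr mulrCA.
pose e := c * normsq r - qform a r; have e_ge0 : 0 <= e by rewrite subr_ge0.
have small t : 0 <= e * t ^+ 2 - 2 * t * normsq r.
  have := ac (fun v => y v + t * r v); rewrite qformD // normsqD qformZ normsqZ ay.
  under eq_bigr do rewrite -mulrA; under [in leRHS]eq_bigr do rewrite -mulrA.
  by rewrite -!mulr_sumr /e normsq_r; lra.
apply/eqP; rewrite eq_le normsq_ge0 andbT leNgt; apply/negP => r_gt0.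
pose s := (e + 1)^-1; have s_gt0 : 0 < s by rewrite invr_gt0; lra.
have es_le1 : e * s <= 1 by rewrite ler_pdivrMr; lra.
pose h := s * normsq r ^+ 2; have h_gt0 : 0 < h by rewrite mulr_gt0 ?exprn_gt0.
have := small (s * normsq r).
have -> : e * (s * normsq r) ^+ 2 - 2 * (s * normsq r) * normsq r = e * s * h - 2 * h.
  by rewrite /h; ring.
by have := ler_wpM2r (ltW h_gt0) es_le1; lra.
Qed.

End QuadraticForms.

Section TopEigenfunction.
Variables (R : realType) (T : finType) (a : T -> T -> R).
Hypothesis a_sym : commutative a.
Hypothesis a_ge0 : forall v w, 0 <= a v w.

Let coords (r : 'rV[R]_#|T|) (v : T) : R := r 0 (enum_rank v).

Lemma qform_continuous : continuous (fun r => qform a (coords r)).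
Proof.
do 2 (apply: continuous_big => [|? _]; first exact: add_continuous).
move=> r; apply: (@cvgM R _ (nbhs r)); first exact: cvg_cst.
by apply: (@cvgM R _ (nbhs r)); exact: coord_continuous.
Qed.

Lemma normsq_continuous : continuous (fun r => normsq (coords r)).
Proof.
apply: continuous_big => [|v _]; first exact: add_continuous.
by move=> r; apply: (@cvgM R _ (nbhs r)); exact: coord_continuous.
Qed.

Lemma rayleigh_maximizer : (0 < #|T|)%N ->
  exists2 x : T -> R, normsq x = 1 & forall y, qform a y <= qform a x * normsq y.
Proof.
case/card_gt0P => v0 _.
pose sphere := ([set r : 'rV[R]_#|T| | forall i, `[-1, 1]%classic (r 0 i)] `&`
  [set r | normsq (coords r) = 1])%classic.
have in_sphere y : normsq y = 1 -> exists2 r, sphere r & coords r = y.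
  move=> y1; have yE : coords (\row_i y (enum_val i)) = y.
    by apply/funext => v; rewrite /coords mxE enum_rankK.
  exists (\row_i y (enum_val i)) => //; split=> [i|] /=; last by rewrite yE.
  by rewrite mxE in_itv /= -ler_norml -ler_sqr ?nnegrE // real_normK ?num_real //
    expr1n -y1 sqr_le_normsq.
have compact_sphere : compact sphere.
  apply: compact_closedI.
    by apply: (@rV_compact R _ (fun=> `[-1, 1]%classic)) => _; exact: segment_compact.
  by apply: (@preimage_closed _ _ _ [set c : R | c = 1]%classic) => [r _|];
    [exact: normsq_continuous | exact: closed_eq].
have [|x /set_mem[_ /= x1] x_max] := compact_EVT_max _ compact_sphere
    (continuous_subspaceT qform_continuous).
  have [|r r_in _] := in_sphere (fun v => (v == v0)%:R); last by exists r.
  rewrite /normsq (bigD1 v0) //= eqxx expr1n big1 ?addr0 // => v /negPf ->.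
  by rewrite expr0n.
exists (coords x) => // y; have [y0|y_gt0] := eqVneq (normsq y) 0.
  by rewrite qform0 ?y0 ?mulr0 //; exact/normsq_eq0P.
have {}y_gt0 : 0 < normsq y by rewrite lt_def y_gt0 normsq_ge0.
pose c := (Num.sqrt (normsq y))^-1.
have c2 : c ^+ 2 = (normsq y)^-1 by rewrite exprVn sqr_sqrtr // ltW.
have [|r r_in rE] := in_sphere (fun v => c * y v).
  by rewrite normsqZ c2 mulVf ?gt_eqF.
have := x_max r (mem_set r_in); rewrite rE qformZ c2.
by rewrite mulrC ler_pdivrMr.
Qed.

Lemma nonneg_top_eigenfunction : (0 < #|T|)%N ->
  exists c : R, (forall y, qform a y <= c * normsq y) /\
  exists x : T -> R, [/\ forall v, 0 <= x v, exists v, 0 < x v & eigenfun a c x].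
Proof.
move=> T0; have [x x1 x_max] := rayleigh_maximizer T0.
exists (qform a x); split=> //; exists (fun v => `|x v|); split=> //.
  have /existsP[v xv] : [exists v, x v != 0].
    apply: contra_eqT x1 => /existsPn x0; rewrite eq_sym.
    by rewrite (iffRL (normsq_eq0P x)) ?oner_eq0 // => v; apply/eqP/negPn/x0.
  by exists v; rewrite normr_gt0.
apply: rayleigh_maximizer_eigenfun => //; rewrite normsq_norm x1 mulr1.
apply/eqP; rewrite eq_le (le_trans (ler_norm _) (qform_le_norm a_ge0 x)) andbT.
by apply: le_trans (x_max _) _; rewrite normsq_norm x1 mulr1.
Qed.

End TopEigenfunction.

Definition adjacency (R : pzSemiRingType) (V : finType) (E : rel V) (v w : V) : R :=
  (E v w)%:R.

Lemma adjacency_ge0 (R : numDomainType) (V : finType) (E : rel V) v w :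
  0 <= adjacency R E v w.
Proof. exact: ler0n. Qed.

Lemma adjacency_le1 (R : numDomainType) (V : finType) (E : rel V) v w :
  adjacency R E v w <= 1.
Proof. by rewrite /adjacency lern1 leq_b1. Qed.

Lemma adjacency_sym (R : pzSemiRingType) (V : finType) (E : rel V) :
  symmetric E -> commutative (adjacency R E).
Proof. by move=> symE v w; rewrite /adjacency symE. Qed.

Section SpectralRadius.
Variables (R : realType) (V : finType) (E : rel V).
Hypothesis symE : symmetric E.

Lemma eigenvalue_adjP (c : R) :
  eigenvalue (adj R E) c <->
  exists2 y, eigenfun (adjacency R E) c y & exists v, y v != 0.
Proof.
have apply_rV (y : V -> R) i :
    ((\row_j y (enum_val j)) *m adj R E) 0 i =
    apply_form (adjacency R E) y (enum_val i).
  rewrite mxE /apply_form [RHS](reindex (@enum_val _ V)); last first.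
    by exists enum_rank => j _; rewrite ?enum_valK ?enum_rankK.
  by apply: eq_bigr => j _; rewrite !mxE mulrC adjacency_sym.
split=> [/eigenvalueP[r rA r_neq0]|[y yA [v yv]]].
  have rE : r = \row_j r 0 (enum_rank (enum_val j)).
    by apply/rowP => j; rewrite mxE enum_valK.
  exists (fun v => r 0 (enum_rank v)).
    by move=> v; rewrite -[v]enum_rankK -apply_rV -rE rA mxE !enum_rankK.
  have /existsP[j rj] : [exists j, r 0 j != 0].
    apply: contra_neqT r_neq0 => /existsPn r0.
    by apply/rowP => j; rewrite mxE; apply/eqP/negPn/r0.
  by exists (enum_val j); rewrite enum_valK.
apply/eigenvalueP; exists (\row_j y (enum_val j)).
  by apply/rowP => j; rewrite apply_rV yA !mxE.
apply: contraNneq yv => /rowP/(_ (enum_rank v)).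
by rewrite !mxE enum_rankK => ->.
Qed.

Lemma lambda_perron : (0 < #|V|)%N ->
  (forall y : V -> R, qform (adjacency R E) y <= lambda R E * normsq y) /\
  exists x, [/\ forall v, 0 <= x v, exists v, 0 < x v &
    eigenfun (adjacency R E) (lambda R E) x].
Proof.
move=> V0; have adj_ge0 := adjacency_ge0 R E.
have [c [ray [x [x_ge0 [v xv] xE]]]] :=
  nonneg_top_eigenfunction (adjacency_sym R symE) adj_ge0 V0.
suff -> : lambda R E = c by split=> //; exists x; split=> //; exists v.
set S := [set `|b| | b in [set b : R | eigenvalue (adj R E) b]]%classic.
have Sc : S c.
  exists c; first by apply/eigenvalue_adjP; exists x => //; exists v; rewrite gt_eqF.
  rewrite ger0_norm // -(pmulr_lge0 _ xv) -xE.
  by apply: sumr_ge0 => w _; rewrite mulr_ge0.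
have ubS : ubound S c.
  move=> _ [b /eigenvalue_adjP[y yE [w yw]] <-].
  rewrite -(ler_pM2r (normsq_gt0 yw)) -{1}(gtr0_norm (normsq_gt0 yw)) -normrM.
  rewrite -(qform_eigenfun yE) -normsq_norm.
  exact: le_trans (qform_le_norm adj_ge0 y) (ray _).
by apply/le_anti; rewrite ge_sup ?ub_le_sup //; exists c.
Qed.

Lemma qform_le_lambda (y : V -> R) : (0 < #|V|)%N ->
  qform (adjacency R E) y <= lambda R E * normsq y.
Proof. by case/lambda_perron. Qed.

Lemma perron_eigenfun : (0 < #|V|)%N ->
  exists x, [/\ forall v, 0 <= x v, exists v, 0 < x v &
    eigenfun (adjacency R E) (lambda R E) x].
Proof. by case/lambda_perron. Qed.

Lemma lambda_ge0 : (0 < #|V|)%N -> 0 <= lambda R E.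
Proof.
case/perron_eigenfun => x [x_ge0 [v xv] xE]; rewrite -(pmulr_lge0 _ xv) -xE.
by apply: sumr_ge0 => w _; rewrite mulr_ge0 ?adjacency_ge0.
Qed.

End SpectralRadius.

(** * Spectral radius of subgraphs and of split graphs *)

Section Pushforward.
Variables (R : realType) (V W : finType) (E : rel V) (E' : rel W) (f : V -> W).
Hypothesis symE : symmetric E.
Hypothesis f_inj : forall v w, nonisol E v -> nonisol E w -> f v = f w -> v = w.
Hypothesis f_edge : forall v w, E v w -> E' (f v) (f w).
Variable x : V -> R.
Hypothesis x_ge0 : forall v, 0 <= x v.

Definition pushforward (w : W) : R := \sum_(v | nonisol E v && (f v == w)) x v.

Lemma sum_pushforward (h : W -> R) :
  \sum_w pushforward w * h w = \sum_(v | nonisol E v) x v * h (f v).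
Proof.
rewrite (partition_big f predT) //=; apply: eq_bigr => w _.
by rewrite mulr_suml; apply: eq_bigr => v /andP[_ /eqP ->].
Qed.

Lemma pushforwardE v : nonisol E v -> pushforward (f v) = x v.
Proof.
move=> nv; rewrite /pushforward (big_pred1 v) // => w /=.
by apply/andP/eqP => [[nw /eqP]|->]; [exact: f_inj | rewrite eqxx].
Qed.

Lemma normsq_pushforward_le : normsq pushforward <= normsq x.
Proof.
rewrite /normsq; under eq_bigr do rewrite expr2.
rewrite sum_pushforward [leRHS](bigID (nonisol E)) /= -[leLHS]addr0; apply: lerD.
  by apply: ler_sum => v nv; rewrite pushforwardE.
by apply: sumr_ge0 => v _; exact: sqr_ge0.
Qed.

Lemma qform_pushforward_ge :
  qform (adjacency R E) x <= qform (adjacency R E') pushforward.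
Proof.
have nonisol_edge v w : ~~ nonisol E w -> adjacency R E v w = 0.
  rewrite /adjacency symE; case: (boolP (E w v)) => // wv /existsP[].
  by exists v.
rewrite [leRHS]qformE sum_pushforward /qform [leLHS](bigID (nonisol E)) /=.
rewrite [X in _ + X <= _]big1 ?addr0 => [|v nv]; last first.
  by rewrite big1 // => w _; rewrite adjacency_sym // nonisol_edge // mul0r.
apply: ler_sum => v _; rewrite /apply_form; under [in leRHS]eq_bigr do rewrite mulrC.
rewrite sum_pushforward mulr_sumr (bigID (nonisol E)) /= [X in _ + X]big1 ?addr0.
  apply: ler_sum => w _; rewrite mulrC -mulrA ler_wpM2l // ler_wpM2l //.
  by rewrite /adjacency ler_nat; case: (boolP (E v w)) => // /f_edge ->.
by move=> w nw; rewrite nonisol_edge // mul0r.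
Qed.

End Pushforward.

Lemma lambda_subgraph (R : realType) (V W : finType) (E : rel V) (E' : rel W) :
  symmetric E -> symmetric E' -> (0 < #|V|)%N ->
  subgraph E E' -> lambda R E <= lambda R E'.
Proof.
move=> symE symE' V0 [f [f_inj f_edge]].
have W0 : (0 < #|W|)%N.
  by case/card_gt0P: V0 => v _; apply/card_gt0P; exists (f v).
have [x [x_ge0 [v xv] xE]] := perron_eigenfun R symE V0.
have x_gt0 : 0 < normsq x by apply: (@normsq_gt0 _ _ _ v); rewrite gt_eqF.
rewrite -(ler_pM2r x_gt0) -(qform_eigenfun xE).
apply: le_trans (qform_pushforward_ge symE f_edge x_ge0) _.
apply: le_trans (qform_le_lambda symE' _ W0) _.
apply: ler_wpM2l; first exact: lambda_ge0.
exact: normsq_pushforward_le.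
Qed.

Lemma edge_nonisol (V : finType) (E : rel V) v w :
  symmetric E -> E v w -> nonisol E v && nonisol E w.
Proof.
move=> symE vw; apply/andP; split; apply/existsP; first by exists w.
by exists v; rewrite symE.
Qed.

Lemma isomorphic_subgraph (V W : finType) (E : rel V) (E' : rel W) :
  symmetric E -> isomorphic E E' -> subgraph E E'.
Proof.
move=> symE [f [f_inj [_ [_ fE]]]]; exists f; split=> // v w vw.
by have /andP[nv nw] := edge_nonisol symE vw; rewrite -fE.
Qed.

Lemma isomorphic_sym (V W : finType) (E : rel V) (E' : rel W) :
  (0 < #|V|)%N -> isomorphic E E' -> isomorphic E' E.
Proof.
case/card_gt0P => v0 _ [f [f_inj [f_ni [f_surj fE]]]].
pose g w := odflt v0 [pick v | nonisol E v && (f v == w)].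
have gP w : nonisol E' w -> nonisol E (g w) /\ f (g w) = w.
  case/f_surj => v [nv fv]; rewrite /g; case: pickP => [u /andP[? /eqP] //|].
  by move=> /(_ v); rewrite nv fv eqxx.
exists g; split=> [w w' /gP[_ gw] /gP[_ gw'] gg|]; first by rewrite -gw gg gw'.
split=> [w /gP[] //|]; split=> [v nv|w w' /gP[nw gw] /gP[nw' gw']].
  have nfv := f_ni _ nv; have [ngf gf] := gP _ nfv.
  by exists (f v); split=> //; exact: f_inj.
by rewrite fE // gw gw'.
Qed.

Lemma lambda_isomorphic (R : realType) (V W : finType) (E : rel V) (E' : rel W) :
  symmetric E -> symmetric E' -> (0 < #|V|)%N ->
  isomorphic E E' -> lambda R E = lambda R E'.
Proof.
move=> symE symE' V0 iso; have [f _] := iso.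
have W0 : (0 < #|W|)%N.
  by case/card_gt0P: V0 => v _; apply/card_gt0P; exists (f v).
apply/le_anti; rewrite !lambda_subgraph //; apply: isomorphic_subgraph => //.
exact: isomorphic_sym.
Qed.

Lemma big_sym_cut (T : Type) (idx : T) (op : Monoid.com_law idx) (V : finType)
    (L : {set V}) (F : V -> V -> T) : commutative F ->
  let cut := \big[op/idx]_(v in L) \big[op/idx]_(w in ~: L) F v w in
  \big[op/idx]_v \big[op/idx]_w F v w =
  op (op (\big[op/idx]_(v in L) \big[op/idx]_(w in L) F v w) (op cut cut))
     (\big[op/idx]_(v in ~: L) \big[op/idx]_(w in ~: L) F v w).
Proof.
move=> symF cut.
have split_sum G : \big[op/idx]_v G v =
    op (\big[op/idx]_(v in L) G v) (\big[op/idx]_(v in ~: L) G v).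
  by rewrite (bigID (mem L)) /=; congr (op _ _); apply: eq_bigl => v; rewrite in_setC.
under eq_bigr do rewrite split_sum.
rewrite split_sum !big_split -/cut /=.
have -> : \big[op/idx]_(v in ~: L) \big[op/idx]_(w in L) F v w = cut.
  by rewrite exchange_big; apply: eq_bigr => v _; apply: eq_bigr => w _.
by rewrite !Monoid.mulmA.
Qed.

Definition qform_on (R : pzRingType) (T : finType) (A : {set T}) (a : T -> T -> R)
    (y : T -> R) : R :=
  \sum_(v in A) \sum_(w in A) a v w * (y v * y w).

Definition apply_form_on (R : pzRingType) (T : finType) (A : {set T})
    (a : T -> T -> R) (y : T -> R) (v : T) : R :=
  \sum_(w in A) a v w * y w.

Section EliminateComplement.
Variables (R : realFieldType) (T : finType) (a : T -> T -> R) (L : {set T}) (l : R).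
Hypothesis a_sym : commutative a.
Hypothesis l_gt0 : 0 < l.

Lemma qform_complete_square y :
  qform a y - l * normsq y =
  qform_on L a y + l^-1 * (\sum_(w in ~: L) apply_form_on L a y w ^+ 2)
    + qform_on (~: L) a y - l * (\sum_(v in L) y v ^+ 2)
  - l^-1 * \sum_(w in ~: L) (apply_form_on L a y w - l * y w) ^+ 2.
Proof.
rewrite /qform (big_sym_cut _ L) => [|v w]; last by rewrite a_sym [y v * _]mulrC.
rewrite -/(qform_on L a y) -/(qform_on (~: L) a y).
have -> : \sum_(v in L) \sum_(w in ~: L) a v w * (y v * y w) =
    \sum_(w in ~: L) y w * apply_form_on L a y w.
  rewrite exchange_big; apply: eq_bigr => w _ /=; rewrite mulr_sumr.
  by apply: eq_bigr => v _; rewrite [a w v]a_sym; ring.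
have -> : normsq y = \sum_(v in L) y v ^+ 2 + \sum_(w in ~: L) y w ^+ 2.
  rewrite /normsq (bigID (mem L)) /=; congr (_ + _).
  by apply: eq_bigl => w; rewrite in_setC.
have -> : \sum_(w in ~: L) (apply_form_on L a y w - l * y w) ^+ 2 =
    \sum_(w in ~: L) apply_form_on L a y w ^+ 2
    - 2 * l * (\sum_(w in ~: L) y w * apply_form_on L a y w)
    + l ^+ 2 * \sum_(w in ~: L) y w ^+ 2.
  by rewrite !mulr_sumr -sumrB -big_split; apply: eq_bigr => w _ /=; ring.
by rewrite /=; field; rewrite gt_eqF.
Qed.

Lemma rayleigh_value_eliminate y : qform a y = l * normsq y ->
  l * (\sum_(v in L) y v ^+ 2) <= qform_on L a y
    + l^-1 * (\sum_(w in ~: L) apply_form_on L a y w ^+ 2) + qform_on (~: L) a y.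
Proof.
move=> yl; have := qform_complete_square y; rewrite yl subrr.
have : 0 <= l^-1 * \sum_(w in ~: L) (apply_form_on L a y w - l * y w) ^+ 2.
  by rewrite mulr_ge0 ?invr_ge0 ?(ltW l_gt0) ?sumr_ge0 // => w _; exact: sqr_ge0.
lra.
Qed.

(* Extending [z] by [l^-1 apply_form_on L a z] outside [L] makes the square vanish. *)
Lemma rayleigh_bound_eliminate z :
  (forall y, qform a y <= l * normsq y) ->
  (forall v w, v \notin L -> w \notin L -> a v w = 0) ->
  qform_on L a z + l^-1 * (\sum_(w in ~: L) apply_form_on L a z w ^+ 2)
    <= l * \sum_(v in L) z v ^+ 2.
Proof.
move=> ray indep.
pose y v := if v \in L then z v else l^-1 * apply_form_on L a z v.
have yL v : v \in L -> y v = z v by rewrite /y => ->.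
have yz w : apply_form_on L a y w = apply_form_on L a z w.
  by apply: eq_bigr => v vL; rewrite yL.
have := qform_complete_square y; rewrite (_ : qform_on (~: L) a y = 0); last first.
  apply: big1 => v; rewrite in_setC => vL; apply: big1 => w; rewrite in_setC => wL.
  by rewrite indep // mul0r.
rewrite [X in _ - l^-1 * X]big1; last first.
  move=> w; rewrite in_setC yz /y => /negPf ->.
  by rewrite mulVKf ?gt_eqF // subrr expr0n.
under eq_bigr do rewrite yz; rewrite (_ : qform_on L a y = qform_on L a z); last first.
  by apply: eq_bigr => v vL; apply: eq_bigr => w wL; rewrite !yL.
under [\sum_(v in L) y v ^+ 2]eq_bigr => v vL do rewrite yL //.
by have := ray y; lra.
Qed.

End EliminateComplement.

Lemma split_graph_sym k m : symmetric (split_graph k m).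
Proof. by move=> i j; rewrite /split_graph eq_sym orbC. Qed.

Section SplitGraphRayleigh.
Variables (R : realType) (k m : nat) (l : R).
Hypothesis k_gt0 : (0 < k)%N.
Hypothesis l_gt0 : 0 < l.
Hypothesis lambda_le : lambda R (split_graph k m) <= l.
Let t := split_t k m.
Let s := split_s k m.

Let a := adjacency R (split_graph k m).
Let clique : {set 'I_(split_n k m)} := [set i : 'I_(split_n k m) | (i < k)%N].

Lemma sum_split_clique (F : nat -> R) : \sum_(i in clique) F i = \sum_(i < k) F i.
Proof.
rewrite (big_ord_widen (split_n k m)); first by apply: eq_bigl => i; rewrite inE.
by rewrite /split_n -addnA leq_addr.
Qed.

Lemma sum_split_outer (F : nat -> R) :
  \sum_(i in ~: clique) F i = \sum_(i < t) F (k + i)%N + F (k + t)%N.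
Proof.
transitivity (\sum_(k <= i < split_n k m) F i).
  rewrite (big_nat_widenl _ 0) // big_mkord; apply: eq_bigl => i.
  by rewrite !inE -leqNgt.
rewrite /split_n addn1 big_nat_recr ?leq_addr //; congr (_ + _).
by rewrite -{1}[k]add0n big_addn addKn big_mkord; apply: eq_bigr => i _; rewrite addnC.
Qed.

Lemma qform_on_split_clique (z : nat -> R) :
  qform_on clique a (fun i => z i) = (\sum_(i < k) z i) ^+ 2 - \sum_(i < k) z i ^+ 2.
Proof.
rewrite -(sum_split_clique z) -(sum_split_clique (fun i => z i ^+ 2)).
rewrite expr2 mulr_suml -sumrB; apply: eq_bigr => i; rewrite inE => ik.
rewrite mulr_sumr (bigD1 i) ?inE //= [X in _ = X - _](bigD1 i) ?inE //=.
rewrite /a /adjacency /split_graph eqxx mul0r add0r expr2 addrAC subrr add0r.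
apply: eq_bigr => j /andP[]; rewrite inE => jk ji.
by rewrite eq_sym ji /split_adj0 ik jk mul1r.
Qed.

Lemma sum_apply_split_outer (z : nat -> R) :
  \sum_(w in ~: clique) apply_form_on clique a (fun i => z i) w ^+ 2 =
  t%:R * (\sum_(i < k) z i) ^+ 2 + (\sum_(i < k | (i < s)%N) z i) ^+ 2.
Proof.
pose h j i : R := if ((j < k + t) || (i < s))%N then z i else 0.
rewrite (eq_bigr (fun j : 'I_(split_n k m) => (\sum_(i < k) h j i) ^+ 2)); last first.
  move=> j; rewrite !inE -leqNgt => kj; congr (_ ^+ 2).
  rewrite -(sum_split_clique (h j)); apply: eq_bigr => i; rewrite inE => ik.
  have -> : a j i = ((j < k + t) || (i < s))%N%:R.
    congr _%:R; rewrite /split_graph /split_adj0 -/t -/s -val_eqE /=.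
    by have: (j < k + t + 1)%N := ltn_ord j; lia.
  by rewrite /h; case: ifP; rewrite ?mul1r ?mul0r.
rewrite (sum_split_outer (fun j => (\sum_(i < k) h j i) ^+ 2)); congr (_ + _).
  rewrite mulr_natl -[t in _ *+ t]card_ord -sumr_const; apply: eq_bigr => j _.
  by congr (_ ^+ 2); apply: eq_bigr => i _; rewrite /h ltn_add2l ltn_ord.
by congr (_ ^+ 2); rewrite [RHS]big_mkcond; apply: eq_bigr => i _; rewrite /h ltnn.
Qed.

Lemma split_rayleigh (z : nat -> R) :
  (\sum_(i < k) z i) ^+ 2 - \sum_(i < k) z i ^+ 2
    + l^-1 * (t%:R * (\sum_(i < k) z i) ^+ 2 + (\sum_(i < k | (i < s)%N) z i) ^+ 2)
  <= l * \sum_(i < k) z i ^+ 2.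
Proof.
have n_gt0 : (0 < #|'I_(split_n k m)|)%N by rewrite card_ord /split_n addn1.
have ray_l y : qform a y <= l * normsq y.
  apply: le_trans (qform_le_lambda (@split_graph_sym k m) y n_gt0) _.
  by rewrite ler_wpM2r ?normsq_ge0.
rewrite -qform_on_split_clique -sum_apply_split_outer
  -(sum_split_clique (fun i => z i ^+ 2)).
apply: rayleigh_bound_eliminate => // [|i j]; first exact/adjacency_sym/split_graph_sym.
rewrite !inE -!leqNgt => ki kj; rewrite /a /adjacency /split_graph /split_adj0 -/t -/s.
have sk : (s < k)%N by rewrite ltn_mod.
by rewrite (_ : _ && _ = false) // -val_eqE /=; lia.
Qed.

Lemma split_lambda_ge : (k * t)%:R <= l ^+ 2 - k.-1%:R * l.
Proof.
have k1 : k.-1%:R = k%:R - 1 :> R by rewrite -[k in RHS](prednK k_gt0) -natr1 addrK.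
have kR : 0 < k%:R :> R by rewrite ltr0n.
have /= := split_rayleigh (fun=> 1).
rewrite expr1n sumr_const card_ord; set Zs := \sum_(i < k | (i < s)%N) 1 => rayl.
rewrite natrM k1 -(ler_pM2l kR).
have := ler_wpM2l (ltW l_gt0) rayl; rewrite mulrDr mulVKf ?gt_eqF //.
by have := sqr_ge0 Zs; lra.
Qed.

End SplitGraphRayleigh.

(** * Boundedness of the Perron vector *)

Lemma ler_sum_nneg_subset (R : numDomainType) (I : finType) (P Q : pred I)
    (F : I -> R) :
  (forall i, P i -> Q i) -> (forall i, 0 <= F i) ->
  \sum_(i | P i) F i <= \sum_(i | Q i) F i.
Proof.
move=> PQ F_ge0; rewrite big_mkcond [leRHS]big_mkcond; apply: ler_sum => i _.
by case: (boolP (P i)) => [/PQ -> //|_]; case: ifP.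
Qed.

Lemma sqr_weighted_sum_le (R : realFieldType) (I : finType) (p f : I -> R) :
  (forall i, 0 <= p i) ->
  (\sum_i p i * f i) ^+ 2 <= (\sum_i p i) * \sum_i p i * f i ^+ 2.
Proof.
move=> p_ge0; set S := \sum_i p i; set M := \sum_i p i * f i.
set Q := \sum_i p i * f i ^+ 2.
have variance : \sum_i \sum_j p i * p j * (f i - f j) ^+ 2 = 2 * (S * Q - M ^+ 2).
  have -> : 2 * (S * Q - M ^+ 2) = Q * S + S * Q - 2 * (M * M) by ring.
  rewrite /Q /S /M !big_distrlr /= mulr_sumr -big_split -sumrB.
  apply: eq_bigr => i _ /=.
  rewrite mulr_sumr -big_split -sumrB; apply: eq_bigr => j _ /=; ring.
have : 0 <= \sum_i \sum_j p i * p j * (f i - f j) ^+ 2.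
  by do 2 (apply: sumr_ge0 => ? _); rewrite mulr_ge0 ?sqr_ge0 ?mulr_ge0.
rewrite variance; lra.
Qed.

Definition edge_sum (R : pzRingType) (V : finType) (E : rel V) (F : V -> V -> R) : R :=
  \sum_v \sum_w adjacency R E v w * F v w.

Lemma handshake (V : finType) (E : rel V) : simple_graph E ->
  (\sum_v \sum_w E v w = 2 * nedges E)%N.
Proof.
case=> symE irrE; rewrite /nedges.
set edges := [set e : {set V} | _].
have edgeP v w : E v w -> [set v; w] \in edges.
  move=> vw; rewrite inE; apply/existsP; exists v; apply/existsP; exists w.
  by rewrite vw eqxx.
rewrite pair_big (eq_bigr (fun p => if E p.1 p.2 then 1 else 0)%N); last first.
  by move=> p _; case: ifP.
rewrite -big_mkcond (partition_big (fun p => [set p.1; p.2]) (mem edges)) =>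
  [|p /edgeP //].
rewrite mulnC -sum_nat_const; apply: eq_bigr => e.
rewrite !inE => /existsP[x /existsP[y /andP[xy /eqP ->]]].
have x_neq_y : x != y by apply: contraTneq xy => ->; rewrite irrE.
rewrite sum1dep_card (_ : [set p | _] = [set (x, y); (y, x)]).
  by rewrite cards2 xpair_eqE negb_and x_neq_y.
apply/setP => -[v w]; rewrite !inE /= !xpair_eqE; apply/andP/orP.
  case=> vw /eqP vw_xy; have := set21 v w; have := set22 v w; rewrite vw_xy !inE.
  by case/pred2P=> wE /pred2P[] vE; move: vw; rewrite wE vE ?irrE // !eqxx;
    [right|left].
by case=> /andP[/eqP -> /eqP ->]; rewrite ?eqxx // symE setUC eqxx.
Qed.

Section EdgeSum.
Variables (R : numFieldType) (V : finType) (E : rel V).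
Implicit Types F G : V -> V -> R.

Lemma edge_sum_ge0 F : (forall v w, 0 <= F v w) -> 0 <= edge_sum E F.
Proof.
by move=> F_ge0; do 2 (apply: sumr_ge0 => ? _); rewrite mulr_ge0 ?adjacency_ge0.
Qed.

Lemma le_edge_sum F G : (forall v w, F v w <= G v w) -> edge_sum E F <= edge_sum E G.
Proof.
move=> FG; apply: ler_sum => v _; apply: ler_sum => w _.
by apply: ler_wpM2l; rewrite ?adjacency_ge0.
Qed.

Lemma edge_sumD F G :
  edge_sum E (fun v w => F v w + G v w) = edge_sum E F + edge_sum E G.
Proof.
by rewrite -big_split; apply: eq_bigr => v _; rewrite -big_split; apply: eq_bigr => w _;
  rewrite mulrDr.
Qed.

Lemma edge_sumZ c F : edge_sum E (fun v w => c * F v w) = c * edge_sum E F.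
Proof.
rewrite mulr_sumr; apply: eq_bigr => v _; rewrite mulr_sumr; apply: eq_bigr => w _.
by rewrite mulrCA.
Qed.

Lemma edge_sumC F : symmetric E -> edge_sum E F = edge_sum E (fun v w => F w v).
Proof.
move=> symE; rewrite /edge_sum exchange_big.
by apply: eq_bigr => v _; apply: eq_bigr => w _; rewrite adjacency_sym.
Qed.

Lemma edge_sum_row_le F v : (forall v w, 0 <= F v w) ->
  \sum_w adjacency R E v w * F v w <= edge_sum E F.
Proof.
move=> F_ge0; rewrite [leRHS](bigD1 v) //= lerDl.
by do 2 (apply: sumr_ge0 => ? _); rewrite mulr_ge0 ?adjacency_ge0.
Qed.

Lemma edge_sum1 : simple_graph E -> edge_sum E (fun _ _ => 1) = 2 * (nedges E)%:R :> R.
Proof.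
move=> gE; rewrite -natrM -handshake // natr_sum; apply: eq_bigr => v _.
by rewrite natr_sum; apply: eq_bigr => w _; rewrite mulr1.
Qed.

End EdgeSum.

Lemma sqr_edge_sum_le (R : realFieldType) (V : finType) (E : rel V) (F : V -> V -> R) :
  simple_graph E ->
  edge_sum E F ^+ 2 <= 2 * (nedges E)%:R * edge_sum E (fun v w => F v w ^+ 2).
Proof.
move=> gE; rewrite -edge_sum1 // /edge_sum !pair_big.
under [X in _ <= X * _]eq_bigr do rewrite mulr1.
by apply: sqr_weighted_sum_le => p; exact: adjacency_ge0.
Qed.

Definition common_nbrs (V : finType) (E : rel V) (U : {set V}) : {set V} :=
  [set w | [forall v in U, E v w]].

Lemma common_nbrsP (V : finType) (E : rel V) (U : {set V}) w :
  reflect (forall v, v \in U -> E v w) (w \in common_nbrs E U).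
Proof. by rewrite inE; apply: forall_inP. Qed.

Lemma common_nbrsU1 (V : finType) (E : rel V) u (U : {set V}) w :
  (w \in common_nbrs E (u |: U)) = E u w && (w \in common_nbrs E U).
Proof.
apply/common_nbrsP/andP => [uUw|[uw /common_nbrsP Uw] v].
  by split; [apply/uUw/setU11 | apply/common_nbrsP => v vU; exact/uUw/setU1r].
by rewrite !inE => /predU1P[->|/Uw].
Qed.

Definition biclique_free (V : finType) (E : rel V) (a b : nat) : Prop :=
  forall U : {set V}, #|U| = a -> (#|common_nbrs E U| < b)%N.

Lemma weighted_mean_le (R : realFieldType) (I : finType) (P : pred I) (p h : I -> R) c :
  (forall i, 0 <= p i) -> \sum_(i | P i) p i <= 1 -> 0 < c ->
  c <= \sum_(i | P i) p i * h i -> exists2 i, P i & c <= h i.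
Proof.
move=> p_ge0 p_le1 c_gt0 mean; apply: contrapT => /forall2NP below.
have gap_ge0 i : P i -> 0 <= p i * (c - h i).
  by case: (below i) => // /negP; rewrite -ltNge => /ltW hc _;
    rewrite mulr_ge0 ?subr_ge0.
have no_gap : \sum_(i | P i) p i * (c - h i) = 0.
  apply/le_anti; rewrite sumr_ge0 // andbT; under eq_bigr do rewrite mulrBr.
  rewrite sumrB -mulr_suml subr_le0; apply: le_trans mean.
  by rewrite ler_piMl // ltW.
move: mean; rewrite big1 ?leNgt ?c_gt0 // => i Pi.
have /eqP := psumr_eq0P gap_ge0 no_gap Pi; rewrite mulf_eq0 => /orP[/eqP ->|].
  by rewrite mul0r.
case: (below i) => // /negP; rewrite -ltNge subr_eq0 => /lt_eqF.
by rewrite eq_sym => ->.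
Qed.

Definition nbr_weight (R : nmodType) (V : finType) (E : rel V) (p : V -> R)
    (v : V) : R :=
  \sum_(u | E u v) p u.

Section DenseWeights.
Variables (R : realFieldType) (V : finType) (E : rel V) (p : V -> R) (q : R).
Hypothesis p_ge0 : forall v, 0 <= p v.
Hypothesis p_le1 : \sum_v p v <= 1.
Hypothesis q_ge0 : 0 <= q.
Hypothesis p_leq : forall v, p v <= q.

Lemma common_nbrs_extend (Y U : {set V}) c : 0 < c ->
  (forall v, v \in Y -> c <= nbr_weight E p v) -> #|U|%:R * q <= c / 2 ->
  0 < \sum_(v in Y :&: common_nbrs E U) p v ->
  exists2 u, u \notin U & c / 2 * (\sum_(v in Y :&: common_nbrs E U) p v) <=
    \sum_(v in Y :&: common_nbrs E (u |: U)) p v.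
Proof.
move=> c_gt0 degY U_small; set Z := Y :&: _; set pZ := \sum_(v in Z) p v => pZ_gt0.
have [|||u uU uZ] := @weighted_mean_le R V [predC U] p
    (fun u => \sum_(v in Z | E u v) p v) (c / 2 * pZ) p_ge0.
- by apply: le_trans p_le1; exact: ler_sum_nneg_subset.
- by rewrite mulr_gt0 ?divr_gt0.
- rewrite mulr_sumr; under [leRHS]eq_bigr do rewrite mulr_sumr big_mkcondr /=.
  rewrite exchange_big /=; apply: ler_sum => v; rewrite inE => /andP[vY _].
  rewrite -big_mkcondr -mulr_suml (eq_bigl _ _ (fun u => andbC _ _)).
  apply: ler_wpM2r => //=.
  have := degY v vY; rewrite /nbr_weight (bigID (mem U)) /=.
  have : \sum_(u | E u v && (u \in U)) p u <= #|U|%:R * q.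
    apply: le_trans (_ : \sum_(u in U) p u <= _).
      by apply: ler_sum_nneg_subset => // u /andP[].
    by rewrite mulr_natl -sumr_const; exact: ler_sum.
  by lra.
exists u => //; apply: le_trans uZ _; apply: ler_sum_nneg_subset => // v.
by rewrite !in_setI common_nbrsU1 => /andP[/andP[-> ->] ->].
Qed.

Lemma greedy_common_nbrs (Y : {set V}) c a : 0 < c ->
  (forall v, v \in Y -> c <= nbr_weight E p v) -> a%:R * q <= c / 2 ->
  0 < \sum_(v in Y) p v ->
  exists2 U : {set V}, #|U| = a &
    (c / 2) ^+ a * (\sum_(v in Y) p v) <= \sum_(v in Y :&: common_nbrs E U) p v.
Proof.
move=> c_gt0 degY + Y_gt0; elim: a => [_|a IH a_small].
  exists set0; first by rewrite cards0.
  rewrite expr0 mul1r (_ : _ :&: _ = Y) //.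
  by apply/setIidPl/subsetP => w _; apply/common_nbrsP => v; rewrite inE.
have [|U Ua UY] := IH.
  by apply: le_trans a_small; rewrite ler_wpM2r // ler_nat.
have [||u uU uY] := common_nbrs_extend (U := U) c_gt0 degY.
- by rewrite Ua; apply: le_trans a_small; rewrite ler_wpM2r // ler_nat.
- by apply: lt_le_trans UY; rewrite mulr_gt0 ?exprn_gt0 ?divr_gt0.
exists (u |: U); first by rewrite cardsU1 uU Ua.
by apply: le_trans uY; rewrite exprS -mulrA ler_wpM2l // ltW ?divr_gt0.
Qed.

Lemma sum_large_nbr_weight_ge d : symmetric E -> 0 < d ->
  2 * d <= edge_sum E (fun v w => p v * p w) ->
  d <= \sum_(v | d <= nbr_weight E p v) p v.
Proof.
move=> symE d_gt0; pose deg := nbr_weight E p.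
have deg_le1 v : deg v <= 1 by apply: le_trans p_le1; exact: ler_sum_nneg_subset.
have -> : edge_sum E (fun v w => p v * p w) = \sum_v p v * deg v.
  apply: eq_bigr => v _; rewrite /deg /nbr_weight mulr_sumr [RHS]big_mkcond.
  by apply: eq_bigr => w _; rewrite adjacency_sym // /adjacency; case: (E w v);
    rewrite ?mul1r ?mul0r.
rewrite (bigID (fun v => d <= deg v)) /=.
have : \sum_(v | d <= deg v) p v * deg v <= \sum_(v | d <= deg v) p v.
  by apply: ler_sum => v _; rewrite ler_piMr.
have : \sum_(v | ~~ (d <= deg v)) p v * deg v <= \sum_(v | ~~ (d <= deg v)) p v * d.
  by apply: ler_sum => v; rewrite -ltNge => /ltW; exact: ler_wpM2l.
have : \sum_(v | ~~ (d <= deg v)) p v <= 1.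
  by apply: le_trans p_le1; exact: ler_sum_nneg_subset.
by move=> /(ler_wpM2r (ltW d_gt0)); rewrite mulr_suml /deg; lra.
Qed.

Lemma dense_weights_concentrate a b d : symmetric E -> biclique_free E a b -> 0 < d ->
  2 * d <= edge_sum E (fun v w => p v * p w) ->
  d <= (2 * a%:R + b%:R * (2 / d) ^+ a) * q.
Proof.
move=> symE free d_gt0 dense; set e := (2 / d) ^+ a.
rewrite leNgt; apply/negP => q_small.
pose Y := [set v | d <= nbr_weight E p v].
have degY v : v \in Y -> d <= nbr_weight E p v by rewrite inE.
have Y_heavy : d <= \sum_(v in Y) p v.
  by under eq_bigl do rewrite inE; exact: sum_large_nbr_weight_ge.
have Y_gt0 : 0 < \sum_(v in Y) p v by exact: lt_le_trans Y_heavy.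
have e_gt0 : 0 < e by rewrite exprn_gt0 ?divr_gt0.
have bq_ge0 : 0 <= b%:R * e * q by rewrite !mulr_ge0 // ltW.
have [|U Ua UY] := greedy_common_nbrs d_gt0 degY _ Y_gt0 (a := a).
  have : 0 <= a%:R * q by rewrite mulr_ge0.
  by lra.
have few : \sum_(v in Y :&: common_nbrs E U) p v <= b%:R * q.
  apply: le_trans (_ : \sum_(v in common_nbrs E U) p v <= _).
    by apply: ler_sum_nneg_subset => // v; rewrite in_setI => /andP[].
  apply: le_trans (_ : \sum_(v in common_nbrs E U) q <= _); first exact: ler_sum.
  by rewrite sumr_const -[leLHS]mulr_natl ler_wpM2r // ler_nat ltnW // free.
have : (d / 2) ^+ a * d <= b%:R * q.
  apply: le_trans few; apply: le_trans UY.
  by rewrite ler_wpM2l // ltW ?exprn_gt0 ?divr_gt0.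
have inv : e * (d / 2) ^+ a = 1.
  by rewrite -exprMn mulf_div [2 * d]mulrC divff ?expr1n // mulf_neq0 ?gt_eqF.
move=> /(ler_wpM2l (ltW e_gt0)); rewrite mulrA inv mul1r.
have : 0 <= a%:R * q by rewrite mulr_ge0.
by lra.
Qed.

End DenseWeights.

Lemma perron_normsq_bound (R : realFieldType) (V : finType) (E : rel V) (x : V -> R)
    (l d : R) (u : V) a b :
  simple_graph E -> biclique_free E a b -> eigenfun (adjacency R E) l x ->
  (forall v, 0 <= x v <= 1) -> x u = 1 -> 0 < l ->
  0 < d -> 4 * d * (nedges E)%:R <= l ^+ 2 ->
  d * normsq x <= 2 * a%:R + b%:R * (2 / d) ^+ a.
Proof.
move=> gE free xE x01 xu l_gt0 d_gt0 few_edges; set N := normsq x.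
have N_gt0 : 0 < N by apply: (@normsq_gt0 _ _ _ u); rewrite xu oner_eq0.
pose D := edge_sum E (fun v w => x v ^+ 2 * x w ^+ 2).
have D_ge0 : 0 <= D by apply: edge_sum_ge0 => v w; rewrite mulr_ge0 ?sqr_ge0.
have D_large : 2 * d * N ^+ 2 <= D.
  have cauchy : (l * N) ^+ 2 <= 2 * (nedges E)%:R * D.
    have -> : l * N = edge_sum E (fun v w => x v * x w) by rewrite -(qform_eigenfun xE).
    apply: le_trans (sqr_edge_sum_le _ gE) _; apply: ler_wpM2l.
      by rewrite mulr_ge0.
    by apply: le_edge_sum => v w; rewrite exprMn.
  rewrite -(ler_pM2l (exprn_gt0 2 l_gt0)).
  by have := ler_wpM2l (ltW d_gt0) cauchy; have := ler_wpM2r D_ge0 few_edges; lra.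
pose p v := x v ^+ 2 / N.
have p_ge0 v : 0 <= p v by rewrite divr_ge0 ?sqr_ge0 // ltW.
have p_le1 : \sum_v p v <= 1 by rewrite -mulr_suml divff // gt_eqF.
have q_ge0 : 0 <= N^-1 by rewrite invr_ge0 ltW.
have p_leq v : p v <= N^-1.
  by have /andP[? ?] := x01 v; rewrite ler_piMl ?expr_le1.
have dense : 2 * d <= edge_sum E (fun v w => p v * p w).
  suff -> : edge_sum E (fun v w => p v * p w) = (N ^+ 2)^-1 * D.
    by rewrite [_^-1 * D]mulrC ler_pdivlMr ?exprn_gt0.
  rewrite -edge_sumZ; apply: eq_bigr => v _; apply: eq_bigr => w _ /=; congr (_ * _).
  by rewrite /p; field; rewrite gt_eqF.
have := dense_weights_concentrate p_ge0 p_le1 q_ge0 p_leq gE.1 free d_gt0 dense.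
by rewrite ler_pdivlMr.
Qed.

(** * Stability *)

Definition degree_in (V : finType) (E : rel V) (A : {set V}) (w : V) : nat :=
  #|[set v in A | E v w]|.

Definition deficient (V : finType) (E : rel V) (A : {set V}) : {set V} :=
  [set w in ~: A | (0 < degree_in E A w < #|A|)%N].

Lemma degree_inE (V : finType) (E : rel V) (A : {set V}) w :
  degree_in E A w = (\sum_(v in A) E v w)%N.
Proof.
rewrite /degree_in -sum1_card big_mkcond [RHS]big_mkcond; apply: eq_bigr => v _.
by rewrite inE; case: (v \in A); case: (E v w).
Qed.

Lemma degree_in_sum (R : pzRingType) (V : finType) (E : rel V) (A : {set V}) w :
  (degree_in E A w)%:R = \sum_(v in A) adjacency R E v w.
Proof. by rewrite degree_inE natr_sum. Qed.

Lemma degree_in_le (V : finType) (E : rel V) (A : {set V}) w :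
  (degree_in E A w <= #|A|)%N.
Proof. by apply/subset_leq_card/subsetP => v; rewrite inE => /andP[]. Qed.

Lemma degree_in_full (V : finType) (E : rel V) (A : {set V}) w :
  degree_in E A w = #|A| -> forall v, v \in A -> E v w.
Proof.
move=> full v vA; have /eqP/setP/(_ v) : [set v in A | E v w] == A.
  by rewrite eqEcard -/(degree_in E A w) full leqnn andbT; apply/subsetP => z /setIdP[].
by rewrite inE vA.
Qed.

Lemma degree_inS (V : finType) (E : rel V) (A A' : {set V}) w :
  A \subset A' -> (degree_in E A w <= degree_in E A' w)%N.
Proof.
move=> AA'; apply/subset_leq_card/subsetP => v; rewrite !inE => /andP[vA ->].
by rewrite (subsetP AA').
Qed.

Lemma exists_subset_card (V : finType) (A : {set V}) n :
  (n <= #|A|)%N -> exists2 B : {set V}, B \subset A & #|B| = n.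
Proof.
move=> nA; have : (0 < #|[set B : {set V} | B \subset A & #|B| == n]|)%N.
  by rewrite cards_draws bin_gt0.
by case/card_gt0P => B; rewrite inE => /andP[BA /eqP Bn]; exists B.
Qed.

Lemma card_large_degree_in (V : finType) (E : rel V) (A : {set V}) a b :
  biclique_free E a b -> (#|[set w | (a <= degree_in E A w)%N]| <= b * 2 ^ #|A|)%N.
Proof.
move=> free; pose P := [set common_nbrs E T | T in [set T in powerset A | #|T| == a]].
apply: leq_trans (_ : #|cover P| <= _)%N.
  apply/subset_leq_card/subsetP => w; rewrite inE => /exists_subset_card[T TA Ta].
  apply/bigcupP; exists (common_nbrs E T).
    apply/imset_f; rewrite !inE Ta eqxx andbT; apply: subset_trans TA _.
    by apply/subsetP => v; rewrite inE => /andP[].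
  by apply/common_nbrsP => v /(subsetP TA); rewrite inE => /andP[].
apply: leq_trans (leq_card_cover P).1 _.
apply: leq_trans (_ : \sum_(S in P) b <= _)%N.
  by apply: leq_sum => _ /imsetP[T /setIdP[_ /eqP Ta] ->]; exact/ltnW/free.
rewrite sum_nat_const mulnC leq_mul2l -card_powerset.
rewrite (leq_trans (leq_imset_card _ _)) ?orbT //.
by apply/subset_leq_card/subsetP => T /setIdP[].
Qed.

Lemma sum_indicator (R : pzRingType) (V : finType) (A : {set V}) :
  \sum_v (v \in A)%:R = #|A|%:R :> R.
Proof.
rewrite -sum1_card natr_sum [RHS]big_mkcond.
by apply: eq_bigr => v _; case: (v \in A).
Qed.

Definition almost_split (R : numDomainType) (V : finType) (E : rel V) (L : {set V})
    (x : V -> R) (l C : R) : Prop :=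
  [/\ forall v, v \in L -> l ^+ 2 * (1 - x v) <= C,
      forall w, w \notin L -> l * x w <= C,
      \sum_(v in ~: L) \sum_(w in ~: L) adjacency R E v w <= C &
      #|deficient E L|%:R <= l * C].

Section Stability.
Variables (R : realFieldType) (V : finType) (E : rel V) (k b B : nat).
Variables (x : V -> R) (l : R) (u : V).
Let L := [set v | 1 / 3 <= x v].
Let beta : R := B%:R.
Hypothesis k_gt0 : (0 < k)%N.
Hypothesis gE : simple_graph E.
Hypothesis free : biclique_free E k.+1 b.
Hypothesis xE : eigenfun (adjacency R E) l x.
Hypothesis x_ge0 : forall v, 0 <= x v.
Hypothesis x_le1 : forall v, x v <= 1.
Hypothesis xu : x u = 1.
Hypothesis eigenvalue_ge : (nedges E)%:R - beta <= l ^+ 2 - k.-1%:R * l.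
Hypothesis kB : (k ^ 2 <= B)%N.
Hypothesis LB : (#|L| <= B)%N.
Hypothesis bLB : (b * 2 ^ #|L| <= B)%N.
(* The numerical constants are not optimized. *)
Hypothesis l_large : 3000 * beta ^+ 5 <= l.

Let A := adjacency R E.
Let nbr v : R := (E u v)%:R.
Let far v : R := (~~ E u v)%:R.
Let heavy v : R := (v \in L)%:R.
Let light v : R := (v \notin L)%:R.
Let K := [set v in L | E u v].
Let slack : R := 3 * beta ^+ 2.

Let symE : symmetric E. Proof. by case: gE. Qed.
Let irrE : irreflexive E. Proof. by case: gE. Qed.
Let A_ge0 v w : 0 <= A v w. Proof. exact: adjacency_ge0. Qed.
Let A_le1 v w : A v w <= 1. Proof. exact: adjacency_le1. Qed.

Let powers_le : [/\ 1 <= beta, beta <= beta ^+ 2, beta ^+ 2 <= beta ^+ 4 &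
  beta ^+ 4 <= beta ^+ 5].
Proof.
have beta_ge1 : 1 <= beta by rewrite ler1n (leq_trans _ kB) // expn_gt0 k_gt0.
have pow m n : (m <= n)%N -> beta ^+ m <= beta ^+ n by exact: ler_weXn2l.
by split; [| exact: (pow 1%N) | exact: pow | exact: pow].
Qed.

Let k_le_beta : k%:R <= beta.
Proof. by rewrite ler_nat (leq_trans _ kB) // -mulnn leq_pmulr. Qed.

Let b_le_beta : b%:R <= beta.
Proof. by rewrite ler_nat (leq_trans _ bLB) // leq_pmulr // expn_gt0. Qed.

Let l_ge1 : 1 <= l.
Proof. by have [] := powers_le; move: l_large; lra. Qed.

Lemma sum_heavy_le : \sum_v heavy v <= beta.
Proof. by rewrite sum_indicator ler_nat. Qed.

Lemma light_entry v : v \notin L -> x v <= 1 / 3.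
Proof. by rewrite inE -ltNge => /ltW. Qed.

Definition edge_excess v w : R :=
  nbr v * far w * (1 - x w) + far v * far w / 2
  + nbr v * light v * (nbr w * light w) / 6
  + nbr v * heavy v * (nbr w * light w) * (1 - x v - x w) + nbr v * x w - 1 / 2.

Lemma edge_excess_sym v w : edge_excess v w + edge_excess w v <= heavy v * heavy w.
Proof.
rewrite /edge_excess /nbr /far /heavy /light.
have := x_ge0 v; have := x_ge0 w; have := x_le1 v; have := x_le1 w.
have := @light_entry v; have := @light_entry w.
case: (E u v); case: (E u w); case: (v \in L); case: (w \in L) => /= Hw Hv;
  try (move: (Hw isT)); try (move: (Hv isT)); lra.
Qed.

Lemma eigenvalue_at_max : l = \sum_v nbr v * x v.
Proof. by have := xE u; rewrite xu mulr1 => <-. Qed.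

Lemma sqr_eigenvalue : l ^+ 2 = edge_sum E (fun v w => nbr v * x w).
Proof.
rewrite expr2 {2}eigenvalue_at_max mulr_sumr; apply: eq_bigr => v _ /=.
by rewrite mulrCA -xE mulr_sumr; apply: eq_bigr => w _; rewrite mulrCA.
Qed.

Lemma edge_sum_excess_le : edge_sum E edge_excess <= beta ^+ 2.
Proof.
have double : 2 * edge_sum E edge_excess <= \sum_v \sum_w heavy v * heavy w.
  rewrite mulr_natl mulr2n {2}edge_sumC // -edge_sumD.
  apply: ler_sum => v _; apply: ler_sum => w _.
  apply: le_trans (_ : A v w * (heavy v * heavy w) <= _).
    by apply: ler_wpM2l => //; exact: edge_excess_sym.
  by rewrite ler_piMl ?mulr_ge0.
have : (\sum_v heavy v) * (\sum_v heavy v) <= beta ^+ 2.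
  by rewrite expr2 ler_pM ?sum_heavy_le //; apply: sumr_ge0.
by move: double; rewrite -big_distrlr /=; have := sqr_ge0 beta; lra.
Qed.

Definition far_gap : R := edge_sum E (fun v w => nbr v * far w * (1 - x w)).

Definition far_edges : R := edge_sum E (fun v w => far v * far w).

Definition light_nbr_edges : R :=
  edge_sum E (fun v w => nbr v * light v * (nbr w * light w)).

Definition heavy_gap : R :=
  edge_sum E (fun v w => nbr v * heavy v * (nbr w * light w) * (1 - x v)).

Definition degree_deficit : R :=
  \sum_w nbr w * light w * (k.-1%:R - (degree_in E K w)%:R) * x w.

Definition low_degree_weight : R :=
  \sum_w nbr w * light w * (degree_in E K w < k.-1)%N%:R * x w.

(* Both [l^2] and the number of edges are sums over ordered edges, so after
   symmetrization the bound is the pointwise inequality [edge_excess_sym]. *)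
Lemma edge_excess_bound :
  far_gap + far_edges / 2 + light_nbr_edges / 6 + heavy_gap + degree_deficit
    <= beta + beta ^+ 2.
Proof.
have degK w : (degree_in E K w)%:R = \sum_v A v w * (nbr v * heavy v) :> R.
  rewrite degree_in_sum big_mkcond; apply: eq_bigr => v _.
  rewrite inE /nbr /heavy -natrM mulnb.
  by rewrite andbC; case: ifP; rewrite ?mulr1 ?mulr0.
have deficitE : degree_deficit =
    k.-1%:R * (\sum_w nbr w * light w * x w)
    - edge_sum E (fun v w => nbr v * heavy v * (nbr w * light w) * x w).
  rewrite /edge_sum exchange_big mulr_sumr -sumrB; apply: eq_bigr => w _ /=.
  have -> : \sum_v A v w * (nbr v * heavy v * (nbr w * light w) * x w) =
      (degree_in E K w)%:R * (nbr w * light w * x w).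
    by rewrite degK mulr_suml; apply: eq_bigr => v _; ring.
  by ring.
have excess : edge_sum E edge_excess =
    far_gap + far_edges / 2 + light_nbr_edges / 6 + heavy_gap
    - edge_sum E (fun v w => nbr v * heavy v * (nbr w * light w) * x w)
    + l ^+ 2 - edge_sum E (fun _ _ => 1) / 2.
  rewrite sqr_eigenvalue /far_gap /far_edges /light_nbr_edges /heavy_gap.
  rewrite /edge_sum !mulr_suml -!sumrN -!big_split.
  apply: eq_bigr => v _ /=; rewrite !mulr_suml -!sumrN -!big_split.
  by apply: eq_bigr => w _ /=; rewrite /edge_excess; field.
have light_le : k.-1%:R * (\sum_w nbr w * light w * x w) <= k.-1%:R * l.
  rewrite ler_wpM2l // eigenvalue_at_max; apply: ler_sum => w _.
  by rewrite ler_wpM2r // ler_piMr // lern1 leq_b1.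
move: excess edge_sum_excess_le eigenvalue_ge light_le.
by rewrite deficitE edge_sum1 //; lra.
Qed.

Lemma max_vertex_heavy : u \in L.
Proof. by rewrite inE xu; lra. Qed.

Lemma heavy_nbrs_sub : K \subset L.
Proof. by apply/subsetP => v /setIdP[]. Qed.

Lemma max_vertex_notin_nbrs : u \notin K.
Proof. by rewrite inE irrE andbF. Qed.

(* A light neighbour of [u] with more than [k - 1] neighbours in [K] has more than
   [k] neighbours in [L], since [u] is another one. *)
Lemma degree_deficit_ge : low_degree_weight - beta ^+ 2 <= degree_deficit.
Proof.
pose X := [set w | (k.+1 <= degree_in E L w)%N].
have X_few : \sum_w (w \in X)%:R * beta <= beta ^+ 2.
  rewrite -mulr_suml sum_indicator expr2 ler_wpM2r // ler_nat.
  exact: leq_trans (card_large_degree_in L free) bLB.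
have in_X w : E u w -> (k.-1 < degree_in E K w)%N -> w \in X.
  rewrite (prednK k_gt0) inE => uw kD; apply: (leq_ltn_trans kD); rewrite !degree_inE.
  rewrite [X in (_ <= X)%N](bigD1 u) ?max_vertex_heavy //= uw ltnS.
  rewrite big_mkcond [X in (_ <= X)%N]big_mkcond; apply: leq_sum => v _; rewrite inE.
  case: eqVneq => [->|_]; first by rewrite irrE andbF.
  by rewrite andbT; case: (v \in L); case: (E u v).
suff : low_degree_weight <= degree_deficit + \sum_w (w \in X)%:R * beta.
  by move: X_few; lra.
have X_ge0 w : 0 <= (w \in X)%:R * beta by rewrite mulr_ge0.
rewrite /degree_deficit -big_split; apply: ler_sum => w _ /=; rewrite /nbr /light.
case: (boolP (E u w)) => uw; last by rewrite !mul0r add0r.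
case: (w \notin L); last by rewrite mulr0 !mul0r add0r.
rewrite !mul1r; have [kD|kD|->] := ltngtP (degree_in E K w) k.-1.
- by rewrite ler_wpDr // ler_wpM2r // lerBrDr nat1r ler_nat.
- rewrite mul0r in_X // mul1r -lerBlDl sub0r -mulNr opprB.
  apply: le_trans (_ : (degree_in E K w)%:R <= _).
    rewrite -[leRHS]mulr1 ler_pM // ?subr_ge0 ?ler_nat ?(ltnW kD) //.
    by rewrite lerBlDr lerDl.
  rewrite ler_nat (leq_trans _ LB) // (leq_trans (degree_inS E w heavy_nbrs_sub)) //.
  exact: degree_in_le.
- by rewrite subrr !mul0r add0r.
Qed.

Lemma excess_terms_bound :
  [/\ far_gap <= slack, far_edges <= 2 * slack, light_nbr_edges <= 6 * slack,
      heavy_gap <= slack & low_degree_weight <= slack].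
Proof.
have x_gap v : 0 <= 1 - x v by rewrite subr_ge0.
have := edge_excess_bound; have := degree_deficit_ge.
have : 0 <= far_gap by apply: edge_sum_ge0 => v w; rewrite !mulr_ge0.
have : 0 <= far_edges by apply: edge_sum_ge0 => v w; rewrite mulr_ge0.
have : 0 <= light_nbr_edges by apply: edge_sum_ge0 => v w; rewrite !mulr_ge0.
have : 0 <= heavy_gap by apply: edge_sum_ge0 => v w; rewrite !mulr_ge0.
have : 0 <= low_degree_weight by apply: sumr_ge0 => w _; rewrite !mulr_ge0.
by have [_ + _ _] := powers_le; rewrite /slack => *; split; lra.
Qed.

Lemma nbr_far_light_bound :
  edge_sum E (fun v w => nbr v * (far w * light w)) <= 2 * slack.
Proof.
have [bound _ _ _ _] := excess_terms_bound.
apply: le_trans (_ : 3 / 2 * slack <= _); last first.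
  by rewrite ler_wpM2r ?mulr_ge0 ?sqr_ge0 //; lra.
apply: le_trans (ler_wpM2l _ bound); last by lra.
rewrite -edge_sumZ; apply: le_edge_sum => v w.
rewrite mulrA mulrCA ler_wpM2l ?mulr_ge0 //.
rewrite /light; have := x_le1 w; have := @light_entry w.
by case: (w \in L) => /= [_|/(_ isT)]; lra.
Qed.

Lemma light_edges_bound : edge_sum E (fun v w => light v * light w) <= 12 * slack.
Proof.
have [_ far_far nbr_nbr _ _] := excess_terms_bound; have nbr_far := nbr_far_light_bound.
apply: le_trans (_ : edge_sum E (fun v w => nbr v * light v * (nbr w * light w)
  + far v * far w + nbr v * (far w * light w) + nbr w * (far v * light v)) <= _).
  apply: le_edge_sum => v w; rewrite /nbr /far /light.
  by case: (E u v); case: (E u w); case: (v \in L); case: (w \in L) => /=; lra.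
rewrite !edge_sumD -/light_nbr_edges -/far_edges.
by rewrite -(edge_sumC (fun v w => nbr v * (far w * light w)) symE); lra.
Qed.

Lemma sum_light_edges_le : \sum_(v in ~: L) \sum_(w in ~: L) A v w <= 36 * beta ^+ 2.
Proof.
apply: le_trans (_ : 12 * slack <= _); last by rewrite /slack; lra.
apply: le_trans light_edges_bound; rewrite big_mkcond; apply: ler_sum => v _ /=.
rewrite in_setC /light; have [_|_] := boolP (v \in L).
  by apply: sumr_ge0 => w _; rewrite mul0r mulr0.
rewrite big_mkcond; apply: ler_sum => w _ /=; rewrite in_setC.
by case: (w \in L); rewrite ?mulr0 ?mul1r ?mulr1.
Qed.

Lemma light_entry_bound w : w \notin L -> l * x w <= 37 * beta ^+ 2.
Proof.
move=> wL; rewrite -xE.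
apply: le_trans (_ : \sum_v heavy v + \sum_v A w v * (light w * light v) <= _).
  rewrite -big_split; apply: ler_sum => v _; rewrite /heavy /light wL /= -/(A w v).
  have := x_le1 v; have := x_ge0 v; have := A_ge0 w v; have := A_le1 w v.
  by case: (v \in L) => /=; nra.
have row : \sum_v A w v * (light w * light v) <= 12 * slack.
  apply: le_trans light_edges_bound.
  by apply: (edge_sum_row_le E w (F := fun v w => _)) => v z; rewrite mulr_ge0.
by have := sum_heavy_le; have [_ + _ _] := powers_le; move: row; rewrite /slack; lra.
Qed.

Definition nbr_light_weight v : R := \sum_w A v w * (nbr w * light w * x w).

Lemma nbr_light_weight_ge v : l * x v - 7 * beta ^+ 2 <= nbr_light_weight v.
Proof.
have far_light : \sum_w A v w * (far w * light w) <= 2 * slack.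
  have [uv|uv] := boolP (E u v).
    apply: le_trans nbr_far_light_bound.
    apply: le_trans (edge_sum_row_le E v _) => [|? ?]; last by rewrite !mulr_ge0.
    by apply: ler_sum => w _; rewrite /nbr uv mul1r.
  have [_ bound _ _ _] := excess_terms_bound; apply: le_trans bound.
  apply: le_trans (edge_sum_row_le E v _) => [|? ?]; last by rewrite mulr_ge0.
  apply: ler_sum => w _; rewrite ler_wpM2l // {2}/far uv mul1r.
  by rewrite ler_piMr // lern1 leq_b1.
have : l * x v <= \sum_w (heavy w + A v w * (far w * light w)
                          + A v w * (nbr w * light w * x w)).
  rewrite -xE; apply: ler_sum => w _; rewrite -/(A v w) /heavy /light /far /nbr.
  have := A_ge0 v w; have := A_le1 v w; have := x_ge0 w; have := x_le1 w.
  by case: (w \in L); case: (E u w) => /=; nra.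
rewrite !big_split /= -/(nbr_light_weight v).
by move: far_light sum_heavy_le; have [_ + _ _] := powers_le; rewrite /slack; lra.
Qed.

Lemma nbr_light_weight_max : nbr_light_weight u = \sum_w nbr w * light w * x w.
Proof.
by apply: eq_bigr => w _; rewrite /A /adjacency /nbr; case: (E u w);
  rewrite ?mul1r ?mul0r.
Qed.

Lemma nbr_light_weight_max_ge : l - beta <= nbr_light_weight u.
Proof.
rewrite nbr_light_weight_max lerBlDr [leLHS]eigenvalue_at_max.
apply: le_trans (_ : \sum_w (nbr w * light w * x w + heavy w) <= _).
  apply: ler_sum => w _; rewrite /nbr /light /heavy; have := x_le1 w; have := x_ge0 w.
  by case: (E u w); case: (w \in L) => /=; lra.
by rewrite big_split lerD2l sum_heavy_le.
Qed.

Lemma nbr_light_weight_max_le : nbr_light_weight u <= l.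
Proof.
rewrite nbr_light_weight_max [leRHS]eigenvalue_at_max; apply: ler_sum => w _.
by rewrite ler_wpM2r // ler_piMr // lern1 leq_b1.
Qed.

Lemma heavy_nbr_entry v : v \in K -> l ^+ 2 * (1 - x v) <= 666 * beta ^+ 4.
Proof.
case/setIdP => vL uv; have [_ _ _ bound _] := excess_terms_bound.
pose d := \sum_w A v w * (nbr w * light w).
have gap_ge0 : 0 <= 1 - x v by rewrite subr_ge0.
have d_gap : d * (1 - x v) <= slack.
  apply: le_trans bound; apply: le_trans (edge_sum_row_le E v _) => [|z w]; last first.
    by rewrite !mulr_ge0 // subr_ge0.
  by rewrite mulr_suml; apply: ler_sum => w _; rewrite /nbr /heavy uv vL !mul1r -mulrA.
have d_weight : l * nbr_light_weight v <= 37 * beta ^+ 2 * d.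
  rewrite !mulr_sumr; apply: ler_sum => w _; rewrite /light.
  have [wL|/light_entry_bound] := boolP (w \in L); first by rewrite !(mulr0, mul0r).
  have : 0 <= A v w * nbr w by rewrite mulr_ge0.
  by rewrite /= !mulr1; nra.
have weight_l : l <= 6 * nbr_light_weight v.
  have := nbr_light_weight_ge v; move: vL l_large l_ge1; rewrite inE.
  by have [? ? ? ?] := powers_le; nra.
have lhs : l ^+ 2 <= 222 * beta ^+ 2 * d.
  rewrite expr2; have := ler_wpM2l (le_trans ler01 l_ge1) weight_l; lra.
apply: le_trans (ler_wpM2r gap_ge0 lhs) _.
have := ler_wpM2l (sqr_ge0 beta) d_gap; rewrite /slack; lra.
Qed.

Definition missed_entry v w : R := (1 - A v w) * (nbr w * light w * x w).

Lemma missed_entry_ge0 v w : 0 <= missed_entry v w.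
Proof. by rewrite !mulr_ge0 // subr_ge0. Qed.

Lemma sum_missed_entry_le v : v \in K ->
  \sum_w missed_entry v w <= 673 * beta ^+ 4.
Proof.
move=> vK; have -> : \sum_w missed_entry v w = nbr_light_weight u - nbr_light_weight v.
  rewrite nbr_light_weight_max -sumrB; apply: eq_bigr => w _.
  by rewrite /missed_entry; ring.
have : l * (1 - x v) <= l ^+ 2 * (1 - x v).
  by rewrite ler_wpM2r ?subr_ge0 // expr2 ler_peMl // (le_trans _ l_ge1).
have := nbr_light_weight_max_le; have := nbr_light_weight_ge v.
by have := heavy_nbr_entry vK; have [_ _ + _] := powers_le; lra.
Qed.

(* Each vertex counted by [nbr_light_weight v0] is either a common neighbour or
   missed by some [v \in T]. *)
Lemma card_common_nbrs_ge v0 (T : {set V}) : T \subset K ->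
  nbr_light_weight v0 - #|T|%:R * (673 * beta ^+ 4) <=
  #|common_nbrs E (v0 |: (u |: T))|%:R.
Proof.
move=> TK.
have missed : \sum_(v in T) \sum_w missed_entry v w <= #|T|%:R * (673 * beta ^+ 4).
  rewrite mulr_natl -sumr_const; apply: ler_sum => v vT.
  exact/sum_missed_entry_le/(subsetP TK).
suff : nbr_light_weight v0 <= #|common_nbrs E (v0 |: (u |: T))|%:R +
    \sum_(v in T) \sum_w missed_entry v w by lra.
rewrite -sum_indicator exchange_big -big_split; apply: ler_sum => w _ /=.
have misses_ge0 : 0 <= \sum_(v in T) missed_entry v w.
  by apply: sumr_ge0 => v _; exact: missed_entry_ge0.
have [_|] := boolP (w \in common_nbrs E _).
  apply: le_trans (_ : 1 <= _); last by rewrite lerDl.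
  by rewrite !mulr_ile1 ?mulr_ge0 // lern1 leq_b1.
rewrite !common_nbrsU1 add0r.
have [v0w|/negPf v0w] := boolP (E v0 w); last by rewrite /A /adjacency v0w mul0r.
have [uw|/negPf uw] := boolP (E u w); last by rewrite /nbr uw !mul0r mulr0.
rewrite inE negb_forall_in => /exists_inP[v vT /negPf vw].
have missv : missed_entry v w = nbr w * light w * x w.
  by rewrite /missed_entry /A /adjacency vw subr0 mul1r.
rewrite (bigD1 v) //= missv /A /adjacency v0w mul1r lerDl.
by apply: sumr_ge0 => z _; exact: missed_entry_ge0.
Qed.

Lemma card_heavy_nbrs : #|K| = k.-1.
Proof.
have [beta_ge1 beta2 beta4 beta5] := powers_le.
have weight_u := nbr_light_weight_max_ge.
apply/eqP; rewrite eqn_leq; apply/andP; split; rewrite leqNgt; apply/negP.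
  rewrite (prednK k_gt0) => /exists_subset_card[T TK Tk].
  have := card_common_nbrs_ge u TK; rewrite setUA setUid Tk.
  have uT : u \notin T by apply: contra max_vertex_notin_nbrs; exact: (subsetP TK).
  have /free/ltnW : #|u |: T| = k.+1 by rewrite cardsU1 uT Tk.
  rewrite -(ler_nat R); have : k%:R * beta ^+ 4 <= beta ^+ 5.
    by rewrite [leRHS]exprS ler_wpM2r ?exprn_ge0 // (le_trans ler01).
  by move: l_large b_le_beta; lra.
move=> few; have [_ _ _ _ bound] := excess_terms_bound.
have : nbr_light_weight u <= slack.
  rewrite nbr_light_weight_max; apply: le_trans bound; apply: ler_sum => w _.
  by rewrite (leq_ltn_trans (degree_in_le E K w) few) mulr1.
by rewrite /slack; move: l_large; lra.
Qed.

Lemma heavy_eq : L = u |: K.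
Proof.
have [beta_ge1 beta2 beta4 beta5] := powers_le.
apply/eqP; rewrite eqEsubset subUset sub1set max_vertex_heavy heavy_nbrs_sub !andbT.
apply/subsetP => v vL; rewrite in_setU1; have [//|vu /=] := eqVneq.
apply/negPn/negP => vK.
have /free/ltnW : #|v |: (u |: K)| = k.+1.
  rewrite !cardsU1 card_heavy_nbrs in_setU1 negb_or vu vK max_vertex_notin_nbrs.
  by rewrite !add1n prednK.
have := card_common_nbrs_ge v (subxx K); rewrite card_heavy_nbrs -(ler_nat R).
have : k.-1%:R * beta ^+ 4 <= beta ^+ 5.
  rewrite [leRHS]exprS ler_wpM2r ?exprn_ge0 ?(le_trans ler01) //.
  by apply: le_trans k_le_beta; rewrite ler_nat leq_pred.
have := nbr_light_weight_ge v; move: vL; rewrite inE => xv.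
have : l * (1 / 3) <= l * x v by rewrite ler_wpM2l // (le_trans ler01).
by move: l_large b_le_beta; lra.
Qed.

Lemma card_heavy : #|L| = k.
Proof.
by rewrite heavy_eq cardsU1 card_heavy_nbrs max_vertex_notin_nbrs add1n prednK.
Qed.

Lemma heavy_entry v : v \in L -> l ^+ 2 * (1 - x v) <= 666 * beta ^+ 4.
Proof.
rewrite heavy_eq => /setU1P[->|]; last exact: heavy_nbr_entry.
by rewrite xu subrr mulr0 mulr_ge0 ?exprn_ge0.
Qed.

(* A deficient neighbour [w] of [u] misses some [v \in K], and [l * x w >= 1]; a
   deficient non-neighbour of [u] has a neighbour in [K]. *)
Lemma deficient_cost w : w \in deficient E L ->
  1 <= l * (\sum_(v in K) missed_entry v w)
    + \sum_v A v w * (nbr v * (far w * light w)).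
Proof.
rewrite !inE card_heavy => /and3P[wL deg_gt0 deg_lt].
have l_ge0 : 0 <= l by rewrite (le_trans ler01).
have miss_ge0 v : 0 <= missed_entry v w by exact: missed_entry_ge0.
have far_ge0 v : 0 <= A v w * (nbr v * (far w * light w)) by rewrite !mulr_ge0.
have lightw : light w = 1 by rewrite /light inE wL.
have [uw|uw] := boolP (E u w).
  have [v vL vw] : exists2 v, v \in L & ~~ E v w.
    apply/exists_inP; rewrite -negb_forall_in.
    apply: contraL deg_lt => /forall_inP full.
    rewrite -leqNgt -card_heavy; apply/subset_leq_card/subsetP => v vL.
    by rewrite inE vL full.
  have vK : v \in K.
    by move: vL; rewrite {1}heavy_eq => /setU1P[vu|//]; rewrite vu uw in vw.
  have lxw : 1 <= l * x w.
    rewrite -xE /apply_form (bigD1 u) //= xu mulr1 {1}/adjacency symE uw lerDl.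
    by apply: sumr_ge0 => z _; rewrite mulr_ge0 ?adjacency_ge0.
  apply: le_trans lxw _; apply: ler_wpDr; first exact: sumr_ge0.
  have missv : missed_entry v w = x w.
    by rewrite /missed_entry /A /adjacency (negPf vw) subr0 lightw /nbr uw !mul1r.
  by rewrite ler_wpM2l // (bigD1 v) //= missv lerDl sumr_ge0.
have [v] := card_gt0P deg_gt0; rewrite inE => /andP[vL vw].
have uv : E u v.
  by move: vL; rewrite heavy_eq => /setU1P[vu|/setIdP[] //]; rewrite -vu vw in uw.
apply: ler_wpDl; first by rewrite mulr_ge0 // sumr_ge0.
have costv : A v w * (nbr v * (far w * light w)) = 1.
  by rewrite /A /adjacency vw /nbr uv /far uw lightw !mul1r.
by rewrite (bigD1 v) //= costv lerDl sumr_ge0.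
Qed.

Lemma card_deficient_le : #|deficient E L|%:R <= l * (679 * beta ^+ 5).
Proof.
have [beta_ge1 beta2 beta4 beta5] := powers_le.
have l_ge0 : 0 <= l by rewrite (le_trans ler01).
have missed : \sum_(v in K) \sum_w missed_entry v w <= 673 * beta ^+ 5.
  apply: le_trans (_ : #|K|%:R * (673 * beta ^+ 4) <= _).
    by rewrite mulr_natl -sumr_const; apply: ler_sum => v; exact: sum_missed_entry_le.
  rewrite card_heavy_nbrs [_ ^+ 5]exprS mulrCA ler_wpM2l //.
  rewrite ler_wpM2r ?exprn_ge0 ?(le_trans ler01) //.
  by apply: le_trans k_le_beta; rewrite ler_nat leq_pred.
suff : #|deficient E L|%:R <=
    l * (\sum_(v in K) \sum_w missed_entry v w)
    + edge_sum E (fun v w => nbr v * (far w * light w)).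
  have := nbr_far_light_bound; have := ler_wpM2l l_ge0 missed.
  have : beta ^+ 5 <= l * beta ^+ 5 by rewrite ler_peMl ?exprn_ge0 ?(le_trans ler01).
  by rewrite /slack; lra.
rewrite exchange_big /edge_sum [X in _ + X]exchange_big mulr_sumr -big_split /=.
rewrite -sum_indicator; apply: ler_sum => w _.
have [/deficient_cost //|_] := boolP (w \in deficient E L).
rewrite addr_ge0 ?mulr_ge0 ?sumr_ge0 // => v _; first exact: missed_entry_ge0.
by rewrite !mulr_ge0.
Qed.

Lemma heavy_almost_split : almost_split E L x l (3000 * beta ^+ 5).
Proof.
have [beta_ge1 beta2 beta4 beta5] := powers_le; split=> [v vL|w wL||].
- by apply: le_trans (heavy_entry vL) _; lra.
- by apply: le_trans (light_entry_bound wL) _; lra.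
- by apply: le_trans sum_light_edges_le _; lra.
- by apply: le_trans card_deficient_le _; rewrite ler_wpM2l ?(le_trans ler01) //; lra.
Qed.

End Stability.

Lemma card_superlevel_le (R : realFieldType) (V : finType) (x : V -> R) (c : R) :
  0 <= c -> c ^+ 2 * #|[set v | c <= x v]|%:R <= normsq x.
Proof.
move=> c_ge0; rewrite -sum_indicator mulr_sumr; apply: ler_sum => v _; rewrite inE.
case: (leP c) => [xv|_]; last by rewrite mulr0 sqr_ge0.
by rewrite mulr1 ler_sqr ?nnegrE // (le_trans c_ge0).
Qed.

Lemma perron_card_heavy (R : realFieldType) (V : finType) (E : rel V) (x : V -> R)
    (l : R) (u : V) a b :
  simple_graph E -> biclique_free E a b -> eigenfun (adjacency R E) l x ->
  (forall v, 0 <= x v <= 1) -> x u = 1 -> 0 < l -> (nedges E)%:R <= 2 * l ^+ 2 ->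
  (#|[set v | 1 / 3 <= x v]%R| <= 72 * (2 * a + b * 16 ^ a))%N.
Proof.
move=> gE free xE x01 xu l_gt0 few; have third : 0 <= 1 / 3 :> R by lra.
have norm_le : 1 / 8 * normsq x <= 2 * a%:R + b%:R * (2 / (1 / 8)) ^+ a.
  by apply: (perron_normsq_bound gE free xE x01 xu l_gt0); lra.
have sixteen : 2 / (1 / 8) = 16 :> R by field.
rewrite -(ler_nat R) natrM natrD !natrM natrX.
by have := card_superlevel_le x third; move: norm_le; rewrite sixteen; lra.
Qed.

Lemma stability (R : realFieldType) (k b : nat) : (0 < k)%N ->
  exists2 C : R, k%:R <= C &
  forall (V : finType) (E : rel V) (x : V -> R) (l : R) (u : V),
  simple_graph E -> biclique_free E k.+1 b -> eigenfun (adjacency R E) l x ->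
  (forall v, 0 <= x v <= 1) -> x u = 1 -> C <= l ->
  (nedges E)%:R - (k ^ 2)%:R <= l ^+ 2 - k.-1%:R * l -> (nedges E)%:R <= 2 * l ^+ 2 ->
  exists2 L : {set V}, #|L| = k & almost_split E L x l C.
Proof.
move=> k_gt0.
pose ell := (72 * (2 * k.+1 + b * 16 ^ k.+1))%N.
pose B := (k ^ 2 + ell + b * 2 ^ ell)%N; pose beta : R := B%:R.
have kB : (k <= B)%N.
  by rewrite /B -!addnA -mulnn (leq_trans (leq_pmulr k k_gt0)) ?leq_addr.
have beta_ge1 : 1 <= beta by rewrite ler1n (leq_trans k_gt0).
have pow m n : (m <= n)%N -> beta ^+ m <= beta ^+ n by exact: ler_weXn2l.
have beta5_ge1 := pow 0%N 5%N isT; rewrite expr0 in beta5_ge1.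
have k_le_beta5 : k%:R <= beta ^+ 5.
  by apply: le_trans (pow 1%N 5%N isT); rewrite ler_nat.
exists (3000 * beta ^+ 5) => [|V E x l u gE free xE x01 xu l_large eigenvalue_ge few].
  by lra.
have x_ge0 v : 0 <= x v by have /andP[] := x01 v.
have x_le1 v : x v <= 1 by have /andP[] := x01 v.
have l_gt0 : 0 < l by lra.
pose L := [set v | 1 / 3 <= x v].
have L_le : (#|L| <= ell)%N := perron_card_heavy gE free xE x01 xu l_gt0 few.
have eigenvalue_ge_beta : (nedges E)%:R - beta <= l ^+ 2 - k.-1%:R * l.
  by apply: le_trans eigenvalue_ge; rewrite lerB // ler_nat /B -addnA leq_addr.
have k2B : (k ^ 2 <= B)%N by rewrite /B -addnA leq_addr.
have LB : (#|L| <= B)%N by rewrite (leq_trans L_le) // /B addnAC leq_addl.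
have bLB : (b * 2 ^ #|L| <= B)%N.
  by rewrite (leq_trans _ (leq_addl _ _)) // leq_mul2l leq_exp2l // L_le orbT.
exists L; first exact: (card_heavy k_gt0 gE free xE x_ge0 x_le1 xu eigenvalue_ge_beta).
exact: (heavy_almost_split k_gt0 gE free xE x_ge0 x_le1 xu eigenvalue_ge_beta).
Qed.

(** * Recognition of split graphs *)

Definition saturated (V : finType) (E : rel V) (A : {set V}) : {set V} :=
  [set w in ~: A | degree_in E A w == #|A|].

Lemma sum_degree_in (V : finType) (E : rel V) (A : {set V}) :
  (\sum_(w in ~: A) degree_in E A w =
   #|A| * #|saturated E A| + \sum_(w in deficient E A) degree_in E A w)%N.
Proof.
rewrite mulnC -sum_nat_const big_mkcond [X in (_ = X + _)%N]big_mkcond.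
rewrite [X in (_ = _ + X)%N]big_mkcond -big_split; apply: eq_bigr => w _ /=.
rewrite !inE; have [//|wA /=] := boolP (w \in A).
have [->|deg_neq] := eqVneq (degree_in E A w) #|A|; first by rewrite ltnn andbF addn0.
by rewrite [X in _ && X]ltn_neqAle deg_neq degree_in_le andbT add0n; case: posnP.
Qed.

Lemma double_nedges_cut (V : finType) (E : rel V) (L : {set V}) : simple_graph E ->
  (2 * nedges E = \sum_(v in L) \sum_(w in L) E v w
    + 2 * (#|L| * #|saturated E L| + \sum_(w in deficient E L) degree_in E L w)
    + \sum_(v in ~: L) \sum_(w in ~: L) E v w)%N.
Proof.
move=> gE.
have cut : (\sum_(v in L) \sum_(w in ~: L) E v w =
            \sum_(w in ~: L) degree_in E L w)%N.
  by rewrite exchange_big; apply: eq_bigr => w _; rewrite degree_inE.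
rewrite -handshake // (big_sym_cut _ L) => [|v w]; last by rewrite gE.1.
by rewrite cut sum_degree_in /= addnn mul2n.
Qed.

Definition nonedges_in (V : finType) (E : rel V) (L : {set V}) : nat :=
  \sum_(v in L) \sum_(w in L) ((v != w) && ~~ E v w).

Lemma sum_edges_in (V : finType) (E : rel V) (L : {set V}) : irreflexive E ->
  (\sum_(v in L) \sum_(w in L) E v w + nonedges_in E L = #|L| * #|L|.-1)%N.
Proof.
move=> irrE; rewrite -big_split -sum_nat_const /=; apply: eq_bigr => v vL.
rewrite -big_split (bigD1 v) //= irrE eqxx add0n (cardsD1 v L) vL add1n /= -sum1_card.
apply: eq_big => [w|w /andP[_ wv]]; first by rewrite !inE andbC.
by rewrite eq_sym wv; case: (E v w).
Qed.

Lemma double_bin2 n : ('C(n, 2) * 2 = n * n.-1)%N.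
Proof. by have := bin_ffact n 2; rewrite ffactnS ffactn1. Qed.

Lemma index_cat_lt (T : eqType) (s1 s2 : seq T) x :
  (index x (s1 ++ s2) < size s1)%N = (x \in s1).
Proof.
by rewrite index_cat; case: ifP => [|_]; rewrite -?index_mem // ltnNge leq_addr.
Qed.

Section SplitGraphRecognition.
Variables (V : finType) (E : rel V) (L : {set V}).
Hypothesis gE : simple_graph E.
Hypothesis L_gt0 : (0 < #|L|)%N.
Hypothesis clique : forall v w, v \in L -> w \in L -> v != w -> E v w.
Hypothesis indep : forall v w, v \notin L -> w \notin L -> ~~ E v w.
Hypothesis few_deficient : (#|deficient E L| <= 1)%N.

Let k := #|L|.
Let T := saturated E L.
Let D := deficient E L.
Let S := [set v in L | [exists w in D, E v w]].

Let symE : symmetric E. Proof. by case: gE. Qed.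
Let irrE : irreflexive E. Proof. by case: gE. Qed.

Let D_uniq w w' : w \in D -> w' \in D -> w = w'.
Proof. by move=> wD w'D; apply: (card_le1_eqP few_deficient). Qed.

Lemma deficient_nbrs w : w \in D -> S = [set v in L | E v w].
Proof.
move=> wD; apply/setP => v; rewrite !inE; congr (_ && _).
by apply/exists_inP/idP => [[w' /(D_uniq wD) -> //]|vw]; exists w.
Qed.

Lemma card_deficient_nbrs : #|S| = \sum_(w in D) degree_in E L w.
Proof.
have [D0|/set0Pn[w wD]] := eqVneq D set0.
  rewrite D0 big_set0; apply: eq_card0 => v; rewrite !inE D0 andbC.
  by case: exists_inP => // -[w]; rewrite inE.
rewrite (big_pred1 w) ?(deficient_nbrs wD) // => w' /=.
by apply/idP/eqP => [w'D|-> //]; exact: D_uniq.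
Qed.

Lemma card_deficient_nbrs_lt : (#|S| < k)%N.
Proof.
have [D0|/set0Pn[w wD]] := eqVneq D set0.
  by rewrite card_deficient_nbrs D0 big_set0.
by rewrite (deficient_nbrs wD); move: wD; rewrite inE => /and3P[].
Qed.

Lemma nedges_split : (nedges E - 'C(k, 2) = #|T| * k + #|S|)%N.
Proof.
have nonedges0 : nonedges_in E L = 0%N.
  apply: big1 => v vL; apply: big1 => w wL.
  by have [//|vw] := eqVneq v w; rewrite clique.
have outer0 : (\sum_(v in ~: L) \sum_(w in ~: L) E v w = 0)%N.
  apply: big1 => v; rewrite inE => vL; apply: big1 => w; rewrite inE.
  by move/(indep vL)/negPf ->.
have := double_nedges_cut L gE; have := sum_edges_in L irrE; have := double_bin2 k.
rewrite nonedges0 outer0 -card_deficient_nbrs -/k -/T; lia.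
Qed.

Lemma split_t_nedges : split_t k (nedges E) = #|T|.
Proof.
rewrite /split_t nedges_split divnMDl // divn_small ?addn0 //.
exact: card_deficient_nbrs_lt.
Qed.

Lemma split_s_nedges : split_s k (nedges E) = #|S|.
Proof.
by rewrite /split_s nedges_split modnMDl modn_small // card_deficient_nbrs_lt.
Qed.

Lemma edge_from_clique v w : v \in L -> w \notin L ->
  E v w = (w \in T) || (v \in S) && (w \in D).
Proof.
move=> vL wL; apply/idP/orP => [vw|[/setIdP[_ /eqP full]|/andP[/setIdP[_ vD] wD]]].
- have deg_gt0 : (0 < degree_in E L w)%N by apply/card_gt0P; exists v; rewrite inE vL.
  have [full|deg_neq] := eqVneq (degree_in E L w) k; [left|right].
    by rewrite !inE wL full eqxx.
  have wD : w \in D by rewrite !inE wL deg_gt0 ltn_neqAle deg_neq degree_in_le.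
  by rewrite wD andbT inE vL; apply/exists_inP; exists w.
- exact: degree_in_full full _ vL.
- by have [w' w'D vw'] := exists_inP vD; rewrite (D_uniq wD w'D).
Qed.

Definition split_arc v w : bool :=
  [|| (v \in L) && (w \in L), (v \in L) && (w \in T) | (v \in S) && (w \in D)].

Lemma edge_split_arc v w : E v w = (v != w) && (split_arc v w || split_arc w v).
Proof.
have notL z : (z \in T) || (z \in D) -> z \notin L by rewrite !inE => /orP[]/andP[].
have S_sub z : z \in S -> z \in L by case/setIdP.
rewrite /split_arc; have [vL|vL] := boolP (v \in L); have [wL|wL] := boolP (w \in L).
- by have [->|vw] := eqVneq v w; [exact: irrE | rewrite clique].
- have -> : v != w by apply: contraTneq vL => ->.
  rewrite edge_from_clique // [(w \in S) && _](contraNF _ wL) ?orbF // =>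
    /andP[/S_sub]//.
- have -> : v != w by apply: contraNneq vL => ->.
  rewrite symE edge_from_clique // [(v \in S) && _](contraNF _ vL) //= =>
    /andP[/S_sub]//.
- rewrite (negPf (indep vL wL)) /= !(contraNF (@S_sub _)) // andbF //.
Qed.

Let cover v := [|| v \in L, v \in T | v \in D].

Lemma nonisol_cover v : nonisol E v -> cover v.
Proof.
rewrite /cover; case/existsP => w vw; have [//|vL /=] := boolP (v \in L).
have wL : w \in L by apply: contraLR vw; exact: indep.
by move: vw; rewrite symE edge_from_clique // => /orP[->|/andP[_ ->]]; rewrite ?orbT.
Qed.

(* Position of a vertex in the split graph: [S] first, so that it receives the
   labels below [#|S|], then the rest of [L], then [T], and finally [D]. *)
Let vs := (enum S ++ enum (L :\: S)) ++ enum T.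
Definition split_label v : nat := index v vs.

Let L_seqE v : (v \in enum S ++ enum (L :\: S)) = (v \in L).
Proof.
rewrite mem_cat !mem_enum in_setD; have [vS|//] := boolP (v \in S).
by case/setIdP: vS => ->.
Qed.

Let size_L_seq : size (enum S ++ enum (L :\: S)) = k.
Proof.
have S_sub : S \subset L by apply/subsetP => v /setIdP[].
by rewrite size_cat -!cardE /k -(cardsID S L) (setIidPr S_sub).
Qed.

Let vs_uniq : uniq vs.
Proof.
rewrite /vs !cat_uniq !enum_uniq !andbT /=; apply/andP; split; apply/hasPn => v.
  by rewrite !mem_enum => /setDP[_].
by rewrite mem_enum L_seqE => /setIdP[]; rewrite inE.
Qed.

Let size_vs : size vs = (k + #|T|)%N.
Proof. by rewrite size_cat size_L_seq -cardE. Qed.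

Lemma split_label_ltS v : (split_label v < #|S|)%N = (v \in S).
Proof. by rewrite /split_label /vs -catA cardE index_cat_lt mem_enum. Qed.

Lemma split_label_ltL v : (split_label v < k)%N = (v \in L).
Proof. by rewrite -size_L_seq index_cat_lt L_seqE. Qed.

Lemma split_label_lt v : (split_label v < k + #|T|)%N = (v \in L) || (v \in T).
Proof. by rewrite -size_vs index_mem mem_cat L_seqE mem_enum. Qed.

Lemma split_label_le v : (split_label v <= k + #|T|)%N.
Proof. by rewrite -size_vs index_size. Qed.

Lemma split_label_inj v w :
  cover v -> cover w -> split_label v = split_label w -> v = w.
Proof.
rewrite /cover !orbA -!split_label_lt => vP wP vw; move: vP wP; rewrite vw.
have [lt_w _ _|_ /= vD wD] := boolP (split_label w < _)%N; last exact: D_uniq.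
have in_vs z : split_label z = split_label w -> z \in vs.
  by rewrite -index_mem size_vs -/(split_label z) => ->.
by rewrite -(nth_index v (in_vs v vw)) -/(split_label v) vw nth_index ?in_vs.
Qed.

Lemma edge_split_label v w : cover v -> cover w ->
  E v w = (split_label v != split_label w) &&
    (split_adj0 k #|T| #|S| (split_label v) (split_label w) ||
     split_adj0 k #|T| #|S| (split_label w) (split_label v)).
Proof.
move=> vP wP; have arcE v' w' : cover w' ->
    split_adj0 k #|T| #|S| (split_label v') (split_label w') = split_arc v' w'.
  have T_notL : (w' \in T) ==> (w' \notin L) by apply/implyP; rewrite !inE => /andP[].
  have D_notLT : (w' \in D) ==> ~~ ((w' \in L) || (w' \in T)).
    by apply/implyP; rewrite !inE => /and3P[/negPf -> _ /ltn_eqF ->].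
  rewrite /cover /split_adj0 /split_arc eqn_leq split_label_le /=.
  rewrite split_label_ltS split_label_lt !split_label_ltL.
  rewrite [(k <= _)%N]leqNgt [(k + _ <= _)%N]leqNgt split_label_lt split_label_ltL.
  by case: (w' \in L) T_notL D_notLT; case: (w' \in T); case: (w' \in D) => //=;
    rewrite ?(andbF, andbT, orbF).
rewrite !arcE // edge_split_arc; congr (~~ _ && _); apply/eqP/eqP => [-> //|].
exact: split_label_inj.
Qed.

Lemma split_label_surj (z : 'I_(split_n k (nedges E))) :
  nonisol (split_graph k (nedges E)) z -> exists2 v, cover v & split_label v = z.
Proof.
case/existsP => z' zz'; have [v0 _] := card_gt0P L_gt0.
have label_le (y : 'I_(split_n k (nedges E))) : (y <= k + #|T|)%N.
  by rewrite -ltnS (leq_trans (ltn_ord y)) // /split_n split_t_nedges addn1.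
have [zt|tz] := ltnP z (k + #|T|).
  exists (nth v0 vs z); last by rewrite /split_label index_uniq ?size_vs.
  by rewrite /cover orbA -split_label_lt /split_label index_uniq ?size_vs // zt.
have zE : nat_of_ord z = (k + #|T|)%N.
  by apply/eqP; rewrite eqn_leq label_le.
have /card_gt0P[w wD] : (0 < #|D|)%N.
  rewrite lt0n; apply: contraTneq zz' => /cards0_eq D0; apply/negP.
  have s0 : split_s k (nedges E) = 0%N.
    by rewrite split_s_nedges card_deficient_nbrs D0 big_set0.
  rewrite /split_graph /split_adj0 s0 split_t_nedges zE /=.
  by have := label_le z'; lia.
exists w; first by rewrite /cover wD !orbT.
rewrite zE; apply/eqP; rewrite eqn_leq split_label_le leqNgt split_label_lt.
by move: wD; rewrite !inE => /and3P[/negPf -> _ /ltn_eqF ->].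
Qed.

Lemma split_graph_recognition : isomorphic E (split_graph k (nedges E)).
Proof.
have label_lt v : (split_label v < split_n k (nedges E))%N.
  by rewrite /split_n split_t_nedges addn1 ltnS split_label_le.
pose f v := Ordinal (label_lt v).
have fE v w : cover v -> cover w -> E v w = split_graph k (nedges E) (f v) (f w).
  by move=> vP wP; rewrite edge_split_label // -split_t_nedges -split_s_nedges.
have f_surj z : nonisol (split_graph k (nedges E)) z -> exists2 v, cover v & f v = z.
  by case/split_label_surj => v vP vz; exists v => //; exact: val_inj.
exists f; split=> [v w /nonisol_cover vP /nonisol_cover wP /(congr1 val)|];
  first exact: split_label_inj.
split=> [v /existsP[w vw]|]; first last.
  split=> [z nz|v w /nonisol_cover vP /nonisol_cover wP]; last exact: fE.
  have [v vP vz] := f_surj z nz; exists v; split=> //.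
  have [z' zz'] := existsP nz.
  have /andP[_ /f_surj[w wP wz]] := edge_nonisol (@split_graph_sym _ _) zz'.
  by apply/existsP; exists w; rewrite fE // vz wz.
have /andP[nv nw] := edge_nonisol symE vw.
by apply/existsP; exists (f w); rewrite -fE // nonisol_cover.
Qed.

End SplitGraphRecognition.

(** * Comparison with the split graph *)

Definition defect (k d : nat) : nat := d * (k - d).

Lemma defectC k d : (d <= k)%N -> defect k (k - d) = defect k d.
Proof. by move=> dk; rewrite /defect subKn // mulnC. Qed.

Lemma defectD k a b : (a + b <= k)%N ->
  (defect k (a + b) + 2 * (a * b) = defect k a + defect k b)%N.
Proof. by move=> /subnKC <-; rewrite /defect; nia. Qed.

Lemma defect_modD k a b : (a < k)%N -> (b < k)%N ->
  (defect k ((a + b) %% k) + 2 * ((0 < a) && (0 < b)) <= defect k a + defect k b)%N.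
Proof.
move=> ak bk; have [abk|kab] := ltnP (a + b) k.
  rewrite modn_small // -defectD ?(ltnW abk) // leq_add2l leq_mul2l /=.
  by case: a b {ak bk abk} => [|a] [|b].
have -> : ((a + b) %% k = k - ((k - a) + (k - b)))%N.
  by rewrite -{1}(subnKC kab) modnDl modn_small; lia.
rewrite defectC; last by lia.
rewrite -(defectC (ltnW ak)) -(defectC (ltnW bk)) -defectD; last by lia.
by rewrite leq_add2l; case: (_ && _); nia.
Qed.

Lemma defect_mod_sum k (I : finType) (P : pred I) (d : I -> nat) :
  (forall i, P i -> d i < k)%N ->
  (defect k ((\sum_(i | P i) d i) %% k) <= \sum_(i | P i) defect k (d i))%N.
Proof.
move=> dk; elim/big_rec2: _ => [|i y1 y2 Pi IH]; first by rewrite mod0n.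
have k_gt0 : (0 < k)%N := leq_ltn_trans (leq0n _) (dk i Pi).
have := @defect_modD k (d i) (y2 %% k)%N (dk i Pi).
by rewrite ltn_mod modnDmr => /(_ k_gt0); move: IH; lia.
Qed.

Lemma defect_mod_addr k a r : (0 < k)%N ->
  (defect k ((a + r) %% k) <= defect k (a %% k) + r * k.-1)%N.
Proof.
move=> k_gt0; elim: r => [|r IH]; first by rewrite addn0 mul0n addn0.
have [->|k_gt1] : k = 1%N \/ (1 < k)%N by lia.
  by rewrite !modn1 /defect.
rewrite addnS -addn1 -modnDml.
have := @defect_modD k ((a + r) %% k)%N 1%N; rewrite ltn_mod => /(_ k_gt0 k_gt1).
have -> : defect k 1 = k.-1 by rewrite /defect mul1n subn1.
by lia.
Qed.

Lemma defect_extremal k (I : finType) (X : {set I}) (d : I -> nat) (r s : nat) :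
  (0 < k)%N -> (forall i, i \in X -> 0 < d i < k)%N ->
  ((\sum_(i in X) d i + r) %% k = s)%N ->
  (k * r + \sum_(i in X) defect k (d i) <= defect k s)%N ->
  r = 0%N /\ (#|X| <= 1)%N.
Proof.
move=> k_gt0 d_range sE extremal.
have d_lt i : i \in X -> (d i < k)%N by case/d_range/andP.
have r0 : r = 0%N.
  have := defect_mod_addr (\sum_(i in X) d i) r k_gt0; rewrite sE.
  by have := defect_mod_sum d_lt; nia.
split=> //; rewrite leqNgt; apply/negP => /card_gt1P[i [j [iX jX ij]]].
move: extremal; rewrite leqNgt -sE r0 muln0 addn0 add0n => /negP; apply.
pose Y := [pred h | (h \in X) && (h != i) && (h != j)].
have split_ij (F : I -> nat) : (\sum_(h in X) F h = F i + F j + \sum_(h | Y h) F h)%N.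
  by rewrite (bigD1 i) //= (bigD1 j) /= ?addnA // jX eq_sym.
have Y_lt h : Y h -> (d h < k)%N by case/andP => /andP[/d_lt].
have := defect_mod_sum Y_lt.
have := @defect_modD k ((d i + d j) %% k)%N ((\sum_(h | Y h) d h) %% k)%N.
rewrite modnDm !ltn_mod k_gt0 => /(_ isT isT).
have := defect_modD (d_lt i iX) (d_lt j jX).
have /andP[-> _] := d_range i iX; have /andP[-> _] := d_range j jX.
by rewrite !split_ij /=; lia.
Qed.

(* [X2] and [Z2] are the squares of the sums of the Perron entries over the clique
   and over the first [s] clique vertices; replacing them by [k ^+ 2] and [s ^+ 2]
   costs [O(C ^+ 5 / l)]. *)
Lemma rounding_error (R : realFieldType) (k l C J r sd sd2 s T X2 Z2 : R) :
  1 <= k -> k <= C -> 0 < l -> 36 * C ^+ 5 <= l ->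
  0 <= J -> J <= C ^+ 2 -> 0 <= r -> r <= C -> 0 <= s -> s <= C ->
  0 <= sd -> sd <= C ^+ 2 * l ->
  k ^+ 2 * (1 - 2 * (C / l ^+ 2)) <= X2 -> X2 <= k ^+ 2 ->
  s ^+ 2 * (1 - 2 * (C / l ^+ 2)) <= Z2 ->
  2 * k * T = 2 * sd + r - J - 2 * s ->
  l * (J / 2) + T * X2 + Z2 - sd2 <= C ^+ 3 / l ->
  (l - k) * J / 2 + k * r / 2 + (k * sd - sd2) <= s * (k - s) + 1 / 4.
Proof.
move=> k_ge1 kC l_gt0 l_large J_ge0 J_le r_ge0 r_le s_ge0 s_le sd_ge0 sd_le.
move=> X2_ge X2_le Z2_ge count main.
have C_ge1 : 1 <= C by exact: le_trans kC.
have pow m n : (m <= n)%N -> C ^+ m <= C ^+ n by exact: ler_weXn2l.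
have C_le : C <= C ^+ 5 := pow 1%N 5%N isT.
have l_ge1 : 1 <= l by lra.
have CC : C <= C ^+ 2 := pow 1%N 2%N isT.
have T_le : `|T| <= 2 * (C ^+ 2 * l).
  have C2l : C ^+ 2 <= C ^+ 2 * l by rewrite ler_peMr // exprn_ge0; lra.
  have : `|2 * k * T| <= 2 * (2 * (C ^+ 2 * l)).
    by rewrite count ler_norml; apply/andP; split; lra.
  rewrite normrM ger0_norm; last by lra.
  by have := ler_wpM2r (normr_ge0 T) k_ge1; lra.
pose e := C ^+ 5 / l.
have e_small : e <= 1 / 36 by rewrite ler_pdivrMr //; lra.
have sqr_delta_le a : 0 <= a -> a <= C -> a ^+ 2 * (C / l ^+ 2) <= C ^+ 3 / l ^+ 2.
  move=> a_ge0 aC; rewrite mulrA ler_wpM2r ?invr_ge0 ?sqr_ge0 // [C ^+ 3]exprSr.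
  by rewrite ler_wpM2r ?ler_sqr ?nnegrE; lra.
have X2_err : T * k ^+ 2 - 4 * e <= T * X2.
  have gap : k ^+ 2 - X2 <= 2 * C ^+ 3 / l ^+ 2.
    by have := sqr_delta_le k; rewrite -mulrA; lra.
  have : T * (k ^+ 2 - X2) <= 2 * (C ^+ 2 * l) * (2 * C ^+ 3 / l ^+ 2).
    apply: le_trans (_ : `|T| * (k ^+ 2 - X2) <= _).
      by rewrite ler_wpM2r ?ler_norm // subr_ge0.
    by rewrite ler_pM // subr_ge0.
  rewrite (_ : _ * (2 * C ^+ 3 / l ^+ 2) = 4 * e); first by lra.
  by rewrite /e; field; rewrite gt_eqF.
have Z2_err : s ^+ 2 - 2 * e <= Z2.
  have : C ^+ 3 / l ^+ 2 <= e.
    rewrite /e ler_pM ?invr_ge0 ?sqr_ge0 ?exprn_ge0 ?pow //; first by lra.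
    by rewrite lef_pV2 ?posrE ?exprn_gt0 // expr2 ler_peMl // ltW.
  by have := sqr_delta_le s; lra.
have C3_err : C ^+ 3 / l <= e by rewrite ler_wpM2r ?invr_ge0 ?(ltW l_gt0) ?pow.
have Tk : T * k ^+ 2 = k * (2 * sd + r - J - 2 * s) / 2 by rewrite -count; field.
by move: main X2_err Z2_err; rewrite Tk; lra.
Qed.

Lemma sqr_ge_near1 (R : realFieldType) (n delta z : R) : 0 <= n -> 0 <= 1 - delta ->
  n * (1 - delta) <= z -> n ^+ 2 * (1 - 2 * delta) <= z ^+ 2.
Proof.
move=> n_ge0 d1 z_ge; have nd_ge0 : 0 <= n * (1 - delta) by rewrite mulr_ge0.
apply: le_trans (_ : (n * (1 - delta)) ^+ 2 <= _).
  by rewrite exprMn ler_wpM2l ?sqr_ge0 //; have := sqr_ge0 delta; lra.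
by rewrite ler_sqr ?nnegrE // (le_trans nd_ge0).
Qed.

Lemma sum_bool_eq0 (V : finType) (A B : {set V}) (P : rel V) :
  (\sum_(v in A) \sum_(w in B) P v w = 0)%N ->
  forall v w, v \in A -> w \in B -> ~~ P v w.
Proof.
move/eqP; rewrite sum_nat_eq0 => /forall_inP sum0 v w vA wB.
by have := sum0 v vA; rewrite sum_nat_eq0 => /forall_inP/(_ w wB); case: (P v w).
Qed.

Section AlmostSplitGraphs.
Variables (R : realType) (V : finType) (E : rel V) (L : {set V}).
Variables (x : V -> R) (l C : R).
Hypothesis gE : simple_graph E.
Hypothesis L_gt0 : (0 < #|L|)%N.
Hypothesis xE : eigenfun (adjacency R E) l x.
Hypothesis x_ge0 : forall v, 0 <= x v.
Hypothesis x_le1 : forall v, x v <= 1.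
Hypothesis L_le : #|L|%:R <= C.
Hypothesis l_large : 36 * C ^+ 5 <= l.
Hypothesis almost : almost_split E L x l C.
Hypothesis lambda_le : lambda R (split_graph #|L| (nedges E)) <= l.
Hypothesis many_edges : ('C(#|L|, 2) <= nedges E)%N.

Let k := #|L|.
Let t := split_t k (nedges E).
Let s := split_s k (nedges E).
Let A := adjacency R E.
Let T := saturated E L.
Let D := deficient E L.
Let deg := degree_in E L.
Let X := \sum_(v in L) x v.
Let Q := \sum_(v in L) x v ^+ 2.
Let delta : R := C / l ^+ 2.

Let symE : symmetric E. Proof. by case: gE. Qed.
Let irrE : irreflexive E. Proof. by case: gE. Qed.
Let A_ge0 v w : 0 <= A v w. Proof. exact: adjacency_ge0. Qed.
Let k_ge1 : 1 <= k%:R :> R. Proof. by rewrite ler1n. Qed.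
Let C_ge1 : 1 <= C. Proof. exact: le_trans L_le. Qed.
Let s_lt : (s < k)%N. Proof. by rewrite ltn_mod. Qed.

Let C_pow m n : (m <= n)%N -> C ^+ m <= C ^+ n.
Proof. exact: ler_weXn2l. Qed.

Let l_gt0 : 0 < l.
Proof. by have := C_pow (leq0n 5); rewrite expr0; move: l_large; lra. Qed.

Let delta_ge0 : 0 <= delta.
Proof. by rewrite divr_ge0 ?exprn_ge0 ?(ltW l_gt0) // (le_trans ler01). Qed.

Let delta_le : delta <= 1 / 36.
Proof.
rewrite ler_pdivrMr ?exprn_gt0 //; have C_le : C <= C ^+ 5 := @C_pow 1%N 5%N isT.
have l_ge1 : 1 <= l by move: l_large C_ge1; lra.
have : l <= l ^+ 2 by rewrite expr2 ler_peMl // ltW.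
by move: l_large; lra.
Qed.

Let deg_range w : w \in D -> (0 < deg w < k)%N.
Proof. by case/setIdP. Qed.

Lemma clique_entry_ge v : v \in L -> 1 - delta <= x v.
Proof.
have [entries _ _ _] := almost; move/entries.
by rewrite -ler_pdivlMl ?exprn_gt0 // mulrC -/delta; lra.
Qed.

Lemma eigenfun_eliminate :
  l * Q <= qform_on L A x + l^-1 * (\sum_(w in ~: L) apply_form_on L A x w ^+ 2)
    + qform_on (~: L) A x.
Proof.
by apply: rayleigh_value_eliminate => //;
  [exact: adjacency_sym | exact: qform_eigenfun].
Qed.

Lemma split_graph_eliminate : exists2 Z : R, s%:R ^+ 2 * (1 - 2 * delta) <= Z ^+ 2 &
  X ^+ 2 - Q + l^-1 * (t%:R * X ^+ 2 + Z ^+ 2) <= l * Q.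
Proof.
have [v0 _] := card_gt0P L_gt0.
have sum_L (F : V -> R) : \sum_(v in L) F v = \sum_(i < k) F (nth v0 (enum L) i).
  by rewrite -[LHS]big_enum /= (big_nth v0) -cardE big_mkord.
exists (\sum_(i < k | (i < s)%N) x (nth v0 (enum L) i)); last first.
  rewrite /X /Q !sum_L.
  exact: (split_rayleigh L_gt0 l_gt0 lambda_le (fun i => x (nth v0 (enum L) i))).
apply: sqr_ge_near1 => //; first by move: delta_le; lra.
rewrite -(big_ord_widen k (fun i => x (nth v0 (enum L) i))) ?(ltnW s_lt) //.
rewrite mulr_natl -[s in leLHS]card_ord -sumr_const; apply: ler_sum => i _.
by apply: clique_entry_ge; rewrite -mem_enum mem_nth // -cardE (ltn_trans _ s_lt).
Qed.

Lemma clique_sum_bounds :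
  k%:R ^+ 2 * (1 - 2 * delta) <= X ^+ 2 /\ X ^+ 2 <= k%:R ^+ 2.
Proof.
split.
  apply: sqr_ge_near1 => //; first by move: delta_le; lra.
  by rewrite mulr_natl -sumr_const; apply: ler_sum => v; exact: clique_entry_ge.
have X_ge0 : 0 <= X by exact: sumr_ge0.
by rewrite ler_sqr ?nnegrE // -sumr_const; exact: ler_sum.
Qed.

Lemma nonedges_weight_ge : (nonedges_in E L)%:R / 2 <= X ^+ 2 - Q - qform_on L A x.
Proof.
have -> : X ^+ 2 - Q - qform_on L A x =
    \sum_(v in L) \sum_(w in L) ((v != w) && ~~ E v w)%:R * (x v * x w).
  have -> : Q = \sum_(v in L) \sum_(w in L) (v == w)%:R * (x v * x w).
    apply: eq_bigr => v vL; rewrite (bigD1 v) //= eqxx mul1r big1 ?addr0 ?expr2 //.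
    by move=> w /andP[_ /negPf wv]; rewrite eq_sym wv mul0r.
  rewrite expr2 big_distrlr -!sumrB; apply: eq_bigr => v _ /=.
  rewrite -!sumrB; apply: eq_bigr => w _ /=; rewrite /A /adjacency.
  have [->|_] := eqVneq v w; first by rewrite irrE /=; ring.
  by case: (E v w) => /=; ring.
rewrite natr_sum mulr_suml; apply: ler_sum => v vL.
rewrite natr_sum mulr_suml; apply: ler_sum => w wL; apply: ler_wpM2l => //.
have d1 : 0 <= 1 - delta by move: delta_le; lra.
apply: le_trans (ler_pM d1 d1 (clique_entry_ge vL) (clique_entry_ge wL)).
by move: delta_le delta_ge0; have := sqr_ge0 delta; nra.
Qed.

Lemma outer_squares_le :
  \sum_(w in ~: L) apply_form_on L A x w ^+ 2 <=
  #|T|%:R * X ^+ 2 + \sum_(w in D) (deg w)%:R ^+ 2.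
Proof.
have apply_ge0 w : 0 <= apply_form_on L A x w.
  by apply: sumr_ge0 => v _; rewrite mulr_ge0.
have apply_le_deg w : apply_form_on L A x w <= (deg w)%:R.
  rewrite /deg degree_in_sum; apply: ler_sum => v _.
  by rewrite [A w v]adjacency_sym // ler_piMr.
have apply_le_X w : apply_form_on L A x w <= X.
  by apply: ler_sum => v _; rewrite ler_piMl // adjacency_le1.
rewrite mulr_natl -sumr_const big_mkcond [X in _ <= X + _]big_mkcond.
rewrite [X in _ <= _ + X]big_mkcond -big_split; apply: ler_sum => w _ /=.
rewrite !inE; have [_|wL /=] := boolP (w \in L); first by rewrite addr0.
have [dwk|dwk] := eqVneq (degree_in E L w) k.
  by rewrite dwk ltnn andbF addr0 ler_sqr ?nnegrE // (le_trans (apply_ge0 w)).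
rewrite add0r [(_ < #|L|)%N]ltn_neqAle dwk degree_in_le andbT.
case: posnP => [dw0|_] /=.
  have := apply_le_deg w; rewrite /deg dw0 => apply_le0.
  have -> : apply_form_on L A x w = 0 by apply: le_anti; rewrite apply_le0 apply_ge0.
  by rewrite expr0n.
by rewrite ler_sqr ?nnegrE.
Qed.

Lemma outer_qform_le : l * qform_on (~: L) A x <= C ^+ 3 / l.
Proof.
have [_ entries outer _] := almost; have C_ge0 : 0 <= C by rewrite (le_trans ler01).
suff : l ^+ 2 * qform_on (~: L) A x <= C ^+ 3.
  by move=> sqr_le; rewrite ler_pdivlMr // mulrAC -expr2.
rewrite [leRHS]exprSr; apply: le_trans (ler_wpM2l (sqr_ge0 C) outer).
rewrite !mulr_sumr; apply: ler_sum => v; rewrite inE => vL.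
rewrite !mulr_sumr; apply: ler_sum => w; rewrite inE => wL.
have -> : l ^+ 2 * (A v w * (x v * x w)) = (l * x v) * (l * x w) * A v w by ring.
by rewrite ler_wpM2r // expr2 ler_pM ?mulr_ge0 ?(ltW l_gt0) ?entries.
Qed.

Let sd := (\sum_(w in D) deg w)%N.
Let sd2 := (\sum_(w in D) deg w ^ 2)%N.
Let r := (\sum_(v in ~: L) \sum_(w in ~: L) E v w)%N.
Let J := nonedges_in E L.

Lemma edge_balance : (2 * (#|T| * k + sd) + r = 2 * (t * k + s) + J)%N.
Proof.
have nedgesE : (nedges E - 'C(k, 2) = t * k + s)%N by exact: divn_eq.
have := double_nedges_cut L gE; have := sum_edges_in L irrE; have := double_bin2 k.
rewrite -/r -/k -/T -/J -/sd [(k * #|T|)%N]mulnC.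
by move: nedgesE many_edges; rewrite -/k; lia.
Qed.

Lemma sum_deg_sqr_le : (sd2 <= k * sd)%N.
Proof.
rewrite big_distrr; apply: leq_sum => w /deg_range /andP[_ /ltnW dk] /=.
by rewrite -mulnn leq_mul2r dk orbT.
Qed.

Lemma sum_defect : (\sum_(w in D) defect k (deg w) = k * sd - sd2)%N.
Proof.
apply/eqP; rewrite -(eqn_add2r sd2) subnK ?sum_deg_sqr_le //; apply/eqP.
rewrite /sd big_distrr -big_split; apply: eq_bigr => w /deg_range /andP[_ /ltnW dk] /=.
by rewrite /defect -mulnn -mulnDr subnK // mulnC.
Qed.

Lemma nonedges_le : J%:R <= C ^+ 2.
Proof.
apply: le_trans (_ : (k * k)%:R <= _).
  rewrite ler_nat (leq_trans (leq_addl (\sum_(v in L) \sum_(w in L) E v w)%N _)) //.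
  by rewrite sum_edges_in // leq_mul2l leq_pred orbT.
by rewrite natrM expr2 ler_pM.
Qed.

Lemma sum_deg_le : sd%:R <= C ^+ 2 * l.
Proof.
have [_ _ _ few] := almost; apply: le_trans (_ : k%:R * #|D|%:R <= _).
  rewrite -natrM ler_nat mulnC -sum_nat_const; apply: leq_sum => w.
  by case/deg_range/andP => _ /ltnW.
by rewrite expr2 -mulrA [C * l]mulrC ler_pM.
Qed.

(* Both eliminations bound [l * Q]; the entries of [x] on [L] are nearly [1], so the
   difference of the two bounds is, up to [O(1 / l)], a combination of integers. *)
Lemma integer_defect_le :
  (l - k%:R) * J%:R / 2 + k%:R * r%:R / 2 + (k%:R * sd%:R - sd2%:R) <=
  s%:R * (k%:R - s%:R) + 1 / 4.
Proof.
have [Z Z_ge split_le] := split_graph_eliminate.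
have [X2_ge X2_le] := clique_sum_bounds.
have [_ _ outer _] := almost.
have main : l * (J%:R / 2) + (t%:R - #|T|%:R) * X ^+ 2 + Z ^+ 2 - sd2%:R <= C ^+ 3 / l.
  have sd2E : \sum_(w in D) (deg w)%:R ^+ 2 = sd2%:R :> R.
    by rewrite natr_sum; apply: eq_bigr => w _; rewrite natrX.
  have := ler_wpM2l (ltW l_gt0) (le_trans split_le eigenfun_eliminate).
  rewrite !(mulrDr l) !mulVKf ?gt_eqF //.
  have := ler_wpM2l (ltW l_gt0) nonedges_weight_ge.
  by have := outer_squares_le; rewrite sd2E; have := outer_qform_le; lra.
have count : 2 * k%:R * (t%:R - #|T|%:R) = 2 * sd%:R + r%:R - J%:R - 2 * s%:R :> R.
  by have /(congr1 (fun n => n%:R : R)) := edge_balance; rewrite !(natrD, natrM); lra.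
have r_le : r%:R <= C.
  by apply: le_trans outer; rewrite natr_sum; apply: ler_sum => v _; rewrite natr_sum.
have s_le : s%:R <= C by apply: le_trans L_le; rewrite ler_nat ltnW.
exact: (rounding_error k_ge1 L_le l_gt0 l_large (ler0n _ _) nonedges_le (ler0n _ _) r_le
  (ler0n _ _) s_le (ler0n _ _) sum_deg_le X2_ge X2_le Z_ge count main).
Qed.

Lemma nonedges_eq0 : J = 0%N.
Proof.
apply/eqP; rewrite -leqn0 leqNgt; apply/negP; rewrite -(ler_nat R) => J_ge1.
have := integer_defect_le; have : sd2%:R <= k%:R * sd%:R :> R.
  by rewrite -natrM ler_nat sum_deg_sqr_le.
have : 0 <= k%:R * r%:R :> R by rewrite mulr_ge0.
have s_le : s%:R <= k%:R :> R by rewrite ler_nat ltnW.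
have : s%:R * (k%:R - s%:R) <= C ^+ 2.
  by rewrite expr2 ler_pM ?subr_ge0 // ?(le_trans s_le) // lerBlDr ler_wpDr // .
have l_k : 0 <= l - k%:R.
  by have := @C_pow 1%N 5%N isT; move: l_large L_le C_ge1; rewrite expr1 -/k; lra.
have := ler_wpM2l l_k J_ge1; have := @C_pow 1%N 5%N isT; have := @C_pow 2%N 5%N isT.
by move: l_large L_le C_ge1; rewrite expr1 -/k; lra.
Qed.

Lemma almost_split_isomorphic : isomorphic E (split_graph k (nedges E)).
Proof.
have balance := edge_balance; rewrite nonedges_eq0 addn0 in balance.
pose q := (t * k + s - (#|T| * k + sd))%N; have rE : r = (2 * q)%N by rewrite /q; lia.
have sum_mod : ((sd + q) %% k = s)%N.
  rewrite -(modnMDl #|T|) (_ : (_ + _ = t * k + s)%N) ?modnMDl ?modn_small // /q; lia.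
have extremal : (k * q + \sum_(w in D) defect k (deg w) <= defect k s)%N.
  have := integer_defect_le; rewrite nonedges_eq0 mulr0 mul0r add0r rE natrM.
  rewrite sum_defect /defect => fin; rewrite -ltnS -(ltr_nat R) -addn1.
  by rewrite !(natrD, natrM) (natrB _ sum_deg_sqr_le) (natrB _ (ltnW s_lt)) natrM; lra.
have [q0 D_le1] := defect_extremal L_gt0 deg_range sum_mod extremal.
have r0 : r = 0%N by rewrite rE q0.
apply: split_graph_recognition => // v w vL wL.
  by have := sum_bool_eq0 nonedges_eq0 vL wL; rewrite negb_and !negbK => /orP[->|].
by apply: (sum_bool_eq0 r0); rewrite in_setC.
Qed.

End AlmostSplitGraphs.

Lemma nedges_gt0_card (V : finType) (E : rel V) : (0 < nedges E)%N -> (0 < #|V|)%N.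
Proof.
case/card_gt0P => e; rewrite inE => /existsP[v _].
by apply/card_gt0P; exists v.
Qed.

Lemma lambda_gt0 (R : realType) (V : finType) (E : rel V) :
  simple_graph E -> (0 < nedges E)%N -> 0 < lambda R E.
Proof.
move=> gE m_gt0; have V_gt0 := nedges_gt0_card m_gt0.
rewrite lt_def (lambda_ge0 R gE.1 V_gt0) andbT; apply/eqP => l0.
have := qform_le_lambda gE.1 (fun=> 1 : R) V_gt0.
rewrite l0 mul0r leNgt => /negP; apply.
suff -> : qform (adjacency R E) (fun=> 1) = 2 * (nedges E)%:R.
  by rewrite mulr_gt0 ?ltr0n.
by rewrite -edge_sum1 //; do 2 (apply: eq_bigr => ? _); rewrite !mulr1.
Qed.

Lemma perron_normalized (R : realType) (V : finType) (E : rel V) :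
  symmetric E -> (0 < #|V|)%N ->
  exists x : V -> R, exists u : V,
    [/\ eigenfun (adjacency R E) (lambda R E) x, forall v, 0 <= x v <= 1 & x u = 1].
Proof.
move=> symE V_gt0; have [y [y_ge0 [v0 y_gt0] yE]] := perron_eigenfun R symE V_gt0.
pose u := [arg max_(v > v0) y v]%O.
have y_le v : y v <= y u by rewrite /u; case: arg_maxP => // w _; apply.
have yu_gt0 : 0 < y u by exact: lt_le_trans (y_le v0).
exists (fun v => y v / y u), u; split=> [v|v|]; last by rewrite divff ?gt_eqF.
  by rewrite mulrA -yE mulr_suml; apply: eq_bigr => w _; rewrite mulrA.
by rewrite divr_ge0 ?(ltW yu_gt0) //= ler_pdivrMr // mul1r.
Qed.

Lemma split_remainder_le k m : (0 < k)%N -> ('C(k, 2) <= m)%N ->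
  (m <= k * split_t k m + k ^ 2)%N.
Proof.
move=> k_gt0 km.
have : (m - 'C(k, 2) = split_t k m * k + split_s k m)%N by exact: divn_eq.
have : (split_s k m < k)%N by rewrite ltn_mod.
have kk : (k * k.-1 + k = k ^ 2)%N by rewrite -mulnSr prednK // mulnn.
by have := double_bin2 k; rewrite mulnC; lia.
Qed.

Lemma biclique_free_extremal (R : realType) (k b : nat) : (0 < k)%N ->
  exists M : nat, forall (V : finType) (E : rel V),
  simple_graph E -> (M <= nedges E)%N -> biclique_free E k.+1 b ->
  lambda R (split_graph k (nedges E)) <= lambda R E ->
  isomorphic E (split_graph k (nedges E)).
Proof.
move=> k_gt0; have [C k_le_C stab] := stability R b k_gt0.
have C_ge1 : 1 <= C by apply: le_trans k_le_C; rewrite ler1n.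
pose B := 36 * C ^+ 5.
have C_le_B : C <= B.
  have : C ^+ 1 <= C ^+ 5 by exact: ler_weXn2l.
  by rewrite expr1 /B; lra.
have B_ge0 : 0 <= B by lra.
exists (Num.bound (2 * B ^+ 2) + 2 * k ^ 2 + 'C(k, 2) + 1)%N => V E gE large free.
set m := nedges E in large *; set l := lambda R E => lam.
have m_gt0 : (0 < m)%N by lia.
have km : ('C(k, 2) <= m)%N by lia.
have V_gt0 := nedges_gt0_card m_gt0.
have l_gt0 : 0 < l by exact: lambda_gt0.
have eigenvalue_ge : m%:R - (k ^ 2)%:R <= l ^+ 2 - k.-1%:R * l.
  apply: le_trans (split_lambda_ge k_gt0 l_gt0 lam).
  by rewrite lerBlDr -natrD ler_nat split_remainder_le.
have m_le : m%:R <= 2 * l ^+ 2.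
  have : 2 * (k ^ 2)%:R <= m%:R :> R by rewrite -natrM ler_nat; lia.
  have : 0 <= k.-1%:R * l by rewrite mulr_ge0 // ltW.
  by move: eigenvalue_ge; lra.
have B_le_l : B <= l.
  have B2_ge0 : 0 <= 2 * B ^+ 2 by rewrite mulr_ge0 ?exprn_ge0.
  have B2_le : 2 * B ^+ 2 <= m%:R.
    by apply: le_trans (ltW (archi_boundP B2_ge0)) _; rewrite ler_nat; lia.
  by rewrite -ler_sqr ?nnegrE ?(ltW l_gt0) //; lra.
have [x [u [xE x01 xu]]] := perron_normalized R gE.1 V_gt0.
have C_le_l : C <= l by exact: le_trans B_le_l.
have [L Lk almost] := stab V E x l u gE free xE x01 xu C_le_l eigenvalue_ge m_le.
rewrite -Lk in k_gt0 k_le_C lam km *.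
apply: almost_split_isomorphic almost lam km => // v; by have /andP[] := x01 v.
Qed.

(** * Forbidden bipartite graphs *)

Lemma proper2_edge (V : finType) (E : rel V) (c : {ffun V -> bool}) x y :
  proper2 E c -> E x y -> c y = ~~ c x.
Proof.
move/forallP/(_ x)/forallP/(_ y)/implyP => cxy /cxy.
by case: (c x); case: (c y).
Qed.

Lemma color_class_le_sigma (V : finType) (E : rel V) : bipartite E ->
  exists2 c : {ffun V -> bool}, proper2 E c &
    (#|[set x | nonisol E x & c x]| <= sigma E)%N.
Proof.
case=> c0 proper_c0.
pose P n := exists2 c : {ffun V -> bool}, proper2 E c &
  (#|[set x | nonisol E x & c x]| <= n)%N.
rewrite -/(P _) /sigma; apply: (big_ind P) => [|m n Pm Pn|c proper_c].
- by exists c0 => //; exact: max_card.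
- by rewrite /minn; case: ifP.
rewrite /minn; case: ifP => _; first by exists c.
exists [ffun x => ~~ c x].
  apply/forallP => x; apply/forallP => y; apply/implyP => xy; rewrite !ffunE.
  by rewrite (proper2_edge proper_c xy); case: (c x).
by apply/subset_leq_card/subsetP => x; rewrite !inE ffunE.
Qed.

Lemma not_star_sigma_gt1 (V : finType) (E : rel V) : (0 < #|V|)%N ->
  symmetric E -> bipartite E -> ~ is_star E -> (1 < sigma E)%N.
Proof.
move=> /card_gt0P[v0 _] symE bipE not_star; rewrite ltnNge; apply/negP => sigma_le1.
have [c proper_c /leq_trans/(_ sigma_le1)] := color_class_le_sigma bipE.
set A := [set x | _ & _] => A_le1; apply: not_star.
have cover x y : E x y -> (x \in A) || (y \in A).
  move=> xy; have /andP[nx ny] := edge_nonisol symE xy.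
  by rewrite !inE nx ny (proper2_edge proper_c xy); case: (c x).
have [A0|/set0Pn[v vA]] := eqVneq A set0.
  by exists v0 => x y /cover; rewrite A0 !inE.
by exists v => x y /cover /orP[] /(card_le1_eqP A_le1 _ _ vA) ->; [left|right].
Qed.

Lemma injection_of_leq_card (T T' : finType) (A : {set T}) (B : {set T'}) :
  (0 < #|T'|)%N -> (#|A| <= #|B|)%N ->
  exists2 f : T -> T', {in A &, injective f} & {in A, forall x, f x \in B}.
Proof.
case/card_gt0P => y0 _ AB.
have index_lt x : x \in A -> (index x (enum A) < size (enum B))%N.
  by move=> xA; rewrite -cardE (leq_trans _ AB) // cardE index_mem mem_enum.
exists (fun x => nth y0 (enum B) (index x (enum A))) => [x y xA yA /eqP|x xA].
  rewrite nth_uniq ?enum_uniq ?index_lt // => /eqP index_eq.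
  have in_enum z : z \in A -> z \in enum A by rewrite mem_enum.
  by rewrite -(nth_index x (in_enum x xA)) index_eq nth_index ?in_enum.
by rewrite -mem_enum mem_nth ?index_lt.
Qed.

Lemma F_free_biclique_free (VF : finType) (EF : rel VF) (V : finType) (E : rel V) :
  (0 < #|VF|)%N -> symmetric EF -> bipartite EF -> simple_graph E ->
  F_free EF E -> biclique_free E (sigma EF) #|VF|.
Proof.
move=> VF_gt0 symF bipF [symE irrE] Ffree U Us; rewrite ltnNge; apply/negP => large.
apply: Ffree; have [c proper_c class_le] := color_class_le_sigma bipF.
set A := [set x | _ & _] in class_le; set W := common_nbrs E U in large.
have V_gt0 : (0 < #|V|)%N by exact: leq_trans VF_gt0 (leq_trans large (max_card _)).
have AU : (#|A| <= #|U|)%N by rewrite Us.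
have AW : (#|~: A| <= #|W|)%N by exact: leq_trans (max_card _) large.
have [f f_inj fU] := injection_of_leq_card V_gt0 AU.
have [g g_inj gW] := injection_of_leq_card V_gt0 AW.
have fg x y : x \in A -> y \notin A -> E (f x) (g y).
  by move=> xA; rewrite -in_setC => /gW/common_nbrsP; apply; exact: fU.
exists (fun x => if x \in A then f x else g x); split=> [x y _ _|x y xy].
  case: ifPn => xA; case: ifPn => yA fg_eq.
  - exact: f_inj.
  - by have := fg _ _ xA yA; rewrite fg_eq irrE.
  - by have := fg _ _ yA xA; rewrite fg_eq irrE.
  - by apply: g_inj; rewrite ?in_setC.
have /andP[nx ny] := edge_nonisol symF xy.
have yA : (y \in A) = (x \notin A) by rewrite !inE nx ny (proper2_edge proper_c xy).
by rewrite yA; case: ifPn => xA; [apply: fg | rewrite symE; apply: fg]; rewrite ?yA ?xA.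
Qed.

Lemma void_subgraph (VF : finType) (EF : rel VF) (V : finType) (E : rel V) :
  #|VF| = 0%N -> subgraph EF E.
Proof.
move=> VF0; have no (x : VF) : False by have := card0_eq VF0 x.
by exists (fun x => match no x with end); split=> x; case: (no x).
Qed.

Theorem theorem1p14 (R : realType) (VF : finType) (EF : rel VF) :
  simple_graph EF -> bipartite EF -> ~ is_star EF ->
  sigma EF = (order_g EF - alpha EF)%N ->
  exists M : nat, forall m : nat, (M <= m)%N ->
    forall (V : finType) (E : rel V),
      simple_graph E -> nedges E = m -> F_free EF E ->
      lambda R E <= lambda R (split_graph (sigma EF).-1 m) /\
      (lambda R E = lambda R (split_graph (sigma EF).-1 m) <->
       isomorphic E (split_graph (sigma EF).-1 m)).
Proof.
move=> [symF irrF] bipF not_star _.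
have [VF0|VF_gt0] := posnP #|VF|.
  by exists 0%N => m _ V E _ _ []; exact: void_subgraph.
have sigma_gt1 := not_star_sigma_gt1 VF_gt0 symF bipF not_star.
have k_gt0 : (0 < (sigma EF).-1)%N by rewrite -ltnS prednK // ltnW.
have [M extremal] := biclique_free_extremal R #|VF| k_gt0.
exists M.+1 => m Mm V E gE Em Ffree; rewrite -{}Em in Mm *.
have free : biclique_free E (sigma EF).-1.+1 #|VF|.
  by rewrite prednK ?(ltnW sigma_gt1) //; exact: F_free_biclique_free.
have iso := extremal V E gE (ltnW Mm) free.
have V_gt0 := nedges_gt0_card (leq_ltn_trans (leq0n M) Mm).
have lambda_iso := lambda_isomorphic R gE.1 (@split_graph_sym _ _) V_gt0.
split; last by split=> [lambda_eq|/lambda_iso //]; apply: iso; rewrite lambda_eq.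
rewrite leNgt; apply/negP => lambda_lt.
by move: (lambda_lt); rewrite (lambda_iso _ _ (iso (ltW lambda_lt))) ltxx.
Qed.
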